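(* Let $\widehat H:T^*M\to\mathbb{R}$ be a continuous function such that $p\mapsto\widehat H(x,p)$ is convex on $T_x^*M$ for every $x\in M$ and $\lim_{|p|_x\to\infty}\widehat H(x,p)=+\infty$ uniformly in $x\in M$. Let $g\in C(\mathbb{R})$ be strictly increasing and differentiable at $u=0$ with $g'(0)>0$. Let $c_0$ be the critical value of the Hamiltonian $(x,p)\mapsto g(0)+\widehat H(x,p)$. Then for every sufficiently small $\lambda>0$ the equation $$g(\lambda u(x))+\widehat H(x,Du(x))=c_0,\qquad x\in M,$$ has a unique continuous viscosity solution $u^\lambda$. Moreover, $u^\lambda$ converges uniformly on $M$, as $\lambda\to0$, to a single viscosity solution of the critical equation $g(0)+\widehat H(x,Du(x))=c_0$, $x\in M$.
   Context: $M$ is a connected compact smooth manifold without boundary, with a smooth Riemannian metric; $|\cdot|_x$ denotes the norm on $T_xM$ and the dual norm on $T^*_xM$. Viscosity solutions: for $F\in C(T^*M\times\mathbb{R})$ and $c\in\mathbb{R}$, a continuous function $u:M\to\mathbb{R}$ is a viscosity subsolution of $F(x,Du(x),u(x))=c$ if for every $\varphi\in C^1(M)$ and $x_0\in M$ with $\varphi\ge u$ and $\varphi(x_0)=u(x_0)$ one has $F(x_0,D\varphi(x_0),\varphi(x_0))\le c$; it is a viscosity supersolution if for every $\psi\in C^1(M)$ and $x_0\in M$ with $\psi\le u$ and $\psi(x_0)=u(x_0)$ one has $F(x_0,D\psi(x_0),\psi(x_0))\ge c$; it is a viscosity solution if it is both. Critical value: for a continuous Hamiltonian $G(x,p)$ on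 $T^*M$ coercive in $p$, its critical value is $c(G):=\inf\{c\in\mathbb{R}: G(x,Du(x))=c \text{ admits a viscosity subsolution}\}$; it is finite and is the unique real $c$ for which $G(x,Du(x))=c$ admits viscosity solutions on $M$. *)

(* Defs.v *)
From HB Require Import structures.
From mathcomp Require Import all_boot all_order all_algebra.
From mathcomp Require Import all_classical all_reals all_analysis.
Set Implicit Arguments.
Unset Strict Implicit.
Unset Printing Implicit Defensive.
Import Order.TTheory GRing.Theory Num.Theory.
Import numFieldNormedType.Exports.
Local Open Scope classical_set_scope.
Local Open Scope ring_scope.

Section EuclideanRegularity.
Context {R : realType} {V W : normedModType R}.

(* [f] is C^k on the open set [A] of a finite-dimensional space [V] iff it has
   directional derivatives that are all C^(k-1). *)
Fixpoint Ck_on (k : nat) (A : set V) (f : V -> W) : Prop :=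
  if k is k'.+1 then
    (forall x v, A x -> derivable f x v) /\ (forall v, Ck_on k' A ('D_v f))
  else {in A, continuous f}.

Definition smooth_on (A : set V) (f : V -> W) : Prop :=
  forall k, Ck_on k A f.

End EuclideanRegularity.

(* The atlas need not be maximal.  Second countability is not a field: it is
   automatic for a compact [M]. *)
Record smooth_atlas (R : realType) (n : nat) (M : topologicalType) := SmoothAtlas {
  chart_index : Type;
  chart_dom : chart_index -> set M;
  chart : chart_index -> M -> 'rV[R]_n;
  chart_inv : chart_index -> 'rV[R]_n -> M;
  chart_img := fun i => chart i @` chart_dom i;
  chart_dom_open : forall i, open (chart_dom i);
  chart_img_open : forall i, open (chart_img i);
  chartK : forall i, {in chart_dom i, cancel (chart i) (chart_inv i)};
  chart_continuous : forall i, {in chart_dom i, continuous (chart i)};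
  chart_inv_continuous : forall i, {in chart_img i, continuous (chart_inv i)};
  chart_cover : forall x, exists i, chart_dom i x;
  chart_transition_smooth : forall i j,
    smooth_on (chart i @` (chart_dom i `&` chart_dom j))
              (chart j \o chart_inv i)
}.

Arguments chart_index {R n M}.

Section ManifoldCalculus.
Context {R : realType} {n : nat} {M : topologicalType}.
Variable A : smooth_atlas R n M.

Definition chart_at (x : M) : chart_index A := sval (cid (chart_cover A x)).

(* A tangent vector at [x] is the family of its coordinate vectors in the charts
   around [x], related by the differentials of the transition maps; the
   irrelevant coordinates, in charts that miss [x], are set to 0. *)
Definition is_tangent (x : M) : {pred chart_index A -> 'rV[R]_n} :=
  fun v => `[< (forall i j, chart_dom i x -> chart_dom j x ->
                 v j = 'd (chart j \o chart_inv i) (chart i x) (v i)) /\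
               (forall i, ~ chart_dom i x -> v i = 0) >].

Fact is_tangent_submod (x : M) : submod_closed (is_tangent x).
Proof.
split.
  by apply/asboolP; split=> // i j _ _; rewrite !fctE linear0.
move=> a u v /asboolP[u1 u2] /asboolP[v1 v2]; apply/asboolP; split.
  by move=> i j xi xj; rewrite !fctE (u1 i j) // (v1 i j) // linearP.
by move=> i xi; rewrite !fctE u2 // v2 // scaler0 addr0.
Qed.

HB.instance Definition _ (x : M) :=
  GRing.isSubmodClosed.Build R (chart_index A -> 'rV[R]_n) (is_tangent x)
    (is_tangent_submod x).

Record tangent (x : M) := Tangent {
  tcoord :> chart_index A -> 'rV[R]_n;
  _ : tcoord \in is_tangent x
}.

HB.instance Definition _ (x : M) := [isSub for @tcoord x].
HB.instance Definition _ (x : M) := [Choice of tangent x by <:].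
HB.instance Definition _ (x : M) :=
  [SubChoice_isSubLmodule of tangent x by <:].

Definition cotangent (x : M) := {linear tangent x -> R^o}.

(* The covector at [x] whose coordinates in the chart [i] are [a]. *)
Definition covec_fun (i : chart_index A) (x : M) (a : 'rV[R]_n)
  (v : tangent x) : R^o := \sum_k a 0 k * v i 0 k.

Fact covec_linear i x a : linear (@covec_fun i x a).
Proof.
move=> c u v; rewrite /covec_fun scaler_sumr -big_split /=.
by apply: eq_bigr => k _; rewrite !mxE mulrDr mulrCA.
Qed.

HB.instance Definition _ i x a :=
  GRing.isLinear.Build R (tangent x) R^o _ (@covec_fun i x a)
    (@covec_linear i x a).

Definition covec i x a : cotangent x := @covec_fun i x a.

Definition C1 (phi : M -> R) : Prop :=
  forall i : chart_index A,
    Ck_on 1 (chart_img i) (phi \o chart_inv i : 'rV[R]_n -> R^o).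

(* The differential at [x]; by the chain rule the choice of a chart around [x]
   is immaterial for [C1] functions. *)
Definition dman_fun (phi : M -> R) (x : M) (v : tangent x) : R^o :=
  'd (phi \o chart_inv (chart_at x) : 'rV[R]_n -> R^o)
     (chart (chart_at x) x) (v (chart_at x)).

Fact dman_linear phi x : linear (@dman_fun phi x).
Proof. by move=> c u v; rewrite /dman_fun -linearP. Qed.

HB.instance Definition _ phi x :=
  GRing.isLinear.Build R (tangent x) R^o _ (@dman_fun phi x)
    (@dman_linear phi x).

Definition dman phi x : cotangent x := @dman_fun phi x.

Record riemannian_metric := RiemannianMetric {
  rdot : forall x, tangent x -> tangent x -> R;
  rdotC : forall x (v w : tangent x), rdot v w = rdot w v;
  rdotP : forall x (a : R) (u v w : tangent x),
    rdot (a *: u + v) w = a * rdot u w + rdot v w;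
  rdot_gt0 : forall x (v : tangent x), v != 0 -> 0 < rdot v v;
  rdot_smooth : forall i : chart_index A, exists G : 'rV[R]_n -> 'M[R]_n,
    (forall k l, smooth_on (chart_img i) (fun y => G y k l : R^o)) /\
    (forall x (v w : tangent x), chart_dom i x ->
      rdot v w = (v i *m G (chart i x) *m (w i)^T) 0 0)
}.

Definition tnorm (rho : riemannian_metric) x (v : tangent x) : R :=
  Num.sqrt (rdot rho v v).

Definition conorm (rho : riemannian_metric) x (p : cotangent x) : R :=
  sup [set `|p v| | v in [set v | tnorm rho v <= 1]].

Definition hamiltonian := forall x : M, cotangent x -> R.

(* Continuity on the total space T*M, read in the bundle charts
   (y, a) |-> (chart_inv i y, covector of coordinates a). *)
Definition hamiltonian_continuous (H : hamiltonian) : Prop :=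
  forall i : chart_index A,
    {in chart_img i `*` [set: 'rV[R]_n],
      continuous (fun z => H (chart_inv i z.1) (covec i (chart_inv i z.1) z.2))}.

Definition hamiltonian_convex (H : hamiltonian) : Prop :=
  forall x (p q : cotangent x) (t : R), 0 <= t <= 1 ->
    H x ((1 - t) \*: p \+ t \*: q) <= (1 - t) * H x p + t * H x q.

Definition hamiltonian_coercive (rho : riemannian_metric) (H : hamiltonian) :
    Prop :=
  forall K : R, exists r : R, forall x (p : cotangent x),
    r <= conorm rho p -> K <= H x p.

(* [F] stands for a function on T*M x R, the last argument being the value of
   the unknown; the equation is F(x, Du(x), u(x)) = c. *)
Definition viscosity_subsolution (F : forall x, cotangent x -> R -> R) (c : R)
    (u : M -> R) : Prop :=
  continuous u /\
  forall (phi : M -> R) (x0 : M), C1 phi -> (forall x, u x <= phi x) ->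
    phi x0 = u x0 -> F x0 (dman phi x0) (phi x0) <= c.

Definition viscosity_supersolution (F : forall x, cotangent x -> R -> R) (c : R)
    (u : M -> R) : Prop :=
  continuous u /\
  forall (psi : M -> R) (x0 : M), C1 psi -> (forall x, psi x <= u x) ->
    psi x0 = u x0 -> c <= F x0 (dman psi x0) (psi x0).

Definition viscosity_solution (F : forall x, cotangent x -> R -> R) (c : R)
    (u : M -> R) : Prop :=
  viscosity_subsolution F c u /\ viscosity_supersolution F c u.

Definition critical_value (G : hamiltonian) : R :=
  inf [set c | exists u, viscosity_subsolution (fun x p _ => G x p) c u].

End ManifoldCalculus.

(* Main.v *)
Require Import Defs.
From HB Require Import structures.
From mathcomp Require Import all_boot all_order all_algebra.
From mathcomp Require Import all_classical all_reals all_analysis.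
From mathcomp Require Import ring lra.
Set Implicit Arguments.
Unset Strict Implicit.
Unset Printing Implicit Defensive.
Import Order.TTheory GRing.Theory Num.Theory.
Import numFieldNormedType.Exports.
Local Open Scope classical_set_scope.
Local Open Scope ring_scope.

(** Put the equation in the form [H(x, Du) = f] and call [u] a subsolution for
    [f] when [H(x, d phi) <= f] at every contact with a C^1 function [phi] from
    above.  A supersolution is a function whose opposite is a subsolution, for
    the opposite right-hand side and the Hamiltonian [(x, p) |-> - H x (- p)];
    so only subsolutions are studied.

    Three facts on subsolutions carry the proof.  (1) Those with a common bound
    on the right-hand side are equicontinuous ([subsol_equicont]): coercivity
    bounds the gradients of the test functions, and a function touched from
    above only with bounded gradients is Lipschitz
    ([lipschitz_of_supergradient]).  (2) They are stable under uniform limits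
    and under suprema ([subsol_stable]).  (3) A sum rule ([sum_rule]), proved by
    doubling the variables: if [s u + t v] is touched from above by [phi], then
    [d phi = s p + t q] where [p] and [q] satisfy the inequalities of [u] and
    [v].  For a convex [H] this says that convex combinations of subsolutions
    are subsolutions ([subsol_convex]); applied to a subsolution [u] and the
    opposite of a supersolution [v] it compares the right-hand sides at a
    maximum point of [u - v] ([comparison_at_max]).

    By (1) and (2) the infimum that defines the critical value is attained
    ([critical_subsol]).  The discounted equation reads
    [H(x, Du) = c0 - g (lam u)]; by Perron's method its largest subsolution
    [u_lam] is a solution ([perron]), and it is the only one because [g] is
    strictly increasing ([discounted_unique]).  A subsolution that is positive
    everywhere would contradict the definition of the critical value, whence
    bounds uniform in [lam] ([discount_bounds]).

    Convergence rests on one inequality ([discount_sandwich]).  Take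
    [nu < lam < mu] small, [e] the distance between [u_nu] and [u_mu], and
    [t] with [(1 - t) nu + t mu = lam].  By convexity
    [phi = (1 - t) u_nu + t u_mu] is a subsolution for the interpolated
    right-hand side, which to first order is
    [c0 - g 0 - g'(0) ((1 - t) nu u_nu + t mu u_mu)].  This differs from
    [c0 - g 0 - g'(0) lam phi] by [g'(0) t (mu - lam) (u_nu - u_mu)], which is
    at most [g'(0) lam e]: hence [phi - 3 e] is a subsolution for the discount
    [lam], and [u_nu - 4 e <= u_lam] by maximality of [u_lam].  Now if [v] and
    [v'] are uniform cluster points of the family as [lam] tends to 0, choosing
    [u_nu], [u_mu] close to [v] and [u_lam] close to [v'] gives [v <= v']
    ([discount_cluster_le]).  So there is only one cluster point; by
    equicontinuity and compactness the family converges to it, and by stability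
    it solves the critical equation. *)

(** * Limits and continuity *)

Lemma cont_near_eq (T U : topologicalType) (f g : T -> U) (x : T) :
  (\forall y \near x, f y = g y) ->
  {for x, continuous f} -> {for x, continuous g}.
Proof.
move=> fg; rewrite /prop_for /continuous_at -(nbhs_singleton fg).
by apply: cvg_trans; apply: near_eq_cvg.
Qed.

Lemma near_gt (R : realType) (T : topologicalType) (f : T -> R) (x : T) (c : R) :
  {for x, continuous f} -> c < f x -> \forall y \near x, c < f y.
Proof. by move=> cf cx; apply: (cvgr_gt (f x)). Qed.

Lemma near_lt (R : realType) (T : topologicalType) (f : T -> R) (x : T) (c : R) :
  {for x, continuous f} -> f x < c -> \forall y \near x, f y < c.
Proof. by move=> cf cx; apply: (cvgr_lt (f x)). Qed.

Lemma continuous_shiftl (R : realType) (c : R) : continuous (fun s : R => c + s).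
Proof. by move=> s; apply: cvgD; [exact: cvg_cst|exact: cvg_id]. Qed.

Lemma continuous_shiftr (R : realType) (c : R) : continuous (fun s : R => s + c).
Proof. by move=> s; apply: cvgD; [exact: cvg_id|exact: cvg_cst]. Qed.

Lemma continuous_at_fst (T U W : topologicalType) (h : T -> W) (p : T * U) :
  {for p.1, continuous h} -> {for p, continuous (fun q : T * U => h q.1)}.
Proof. by move=> ch; apply: continuous_comp => //; exact: cvg_fst. Qed.

Lemma continuous_at_snd (T U W : topologicalType) (h : U -> W) (p : T * U) :
  {for p.2, continuous h} -> {for p, continuous (fun q : T * U => h q.2)}.
Proof. by move=> ch; apply: continuous_comp => //; exact: cvg_snd. Qed.

Lemma continuous_at_pair (T U W : topologicalType) (f : T -> U) (g : T -> W) (x : T) :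
  {for x, continuous f} -> {for x, continuous g} ->
  {for x, continuous (fun t => (f t, g t))}.
Proof. by move=> cf cg; exact: cvg_pair. Qed.

Lemma continuous_at_sum (R : realType) (T : topologicalType) (W : normedModType R) (I : finType)
    (F : I -> T -> W) (x : T) :
  (forall k, {for x, continuous (F k)}) -> {for x, continuous (fun y => \sum_k F k y)}.
Proof.
move=> H; suff : forall r : seq I, {for x, continuous (fun y => \sum_(k <- r) F k y)} by exact.
elim=> [|k r IH].
  apply: (@cont_near_eq _ _ (cst 0)); last exact: cst_continuous.
  by near=> y; rewrite big_nil.
apply: (@cont_near_eq _ _ (fun y => F k y + \sum_(j <- r) F j y)); last exact: continuousD.
by near=> y; rewrite big_cons.
Unshelve. all: by end_near. Qed.

Lemma continuous_lincomb (R : realType) (T : topologicalType) (s t : R) (u v : T -> R) :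
  continuous u -> continuous v -> continuous (fun x => s * u x + t * v x).
Proof.
move=> uc vc x; apply: (@continuousD R R^o T (fun x => s * u x) (fun x => t * v x)).
  by apply: (@continuousM R T (cst s) u x); [exact: cst_continuous|exact: uc].
by apply: (@continuousM R T (cst t) v x); [exact: cst_continuous|exact: vc].
Qed.

(** How a cluster point is used below: it is approached by members of the
    family that have any given eventual property. *)
Lemma cluster_near (T : topologicalType) (I : Type) (F : set_system I) (f : I -> T) (x : T)
  (P : T -> Prop) (Q : I -> Prop) : Filter F ->
  cluster (f @ F) x -> (\forall y \near x, P y) -> F Q -> exists2 i, Q i & P (f i).
Proof.
move=> FF cl Px FQ.
have : (f @ F) (f @` Q).
  by rewrite /nbhs /=; apply: (filterS _ FQ) => i Qi; exists i.
by move=> /cl /(_ Px)[_ [[i Qi <-] Pi]]; exists i.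
Qed.

Lemma at_right0_itv (R : realType) (b : R) : 0 < b -> \forall e \near 0^'+, 0 < e < b.
Proof.
move=> b0; near=> e; apply/andP; split; near: e; first exact: nbhs_right_gt.
exact: nbhs_right_lt.
Unshelve. all: by end_near. Qed.

(** * Differentiability of functions with continuous partial derivatives *)

Section C1Euclid.
Context {R : realType} {n : nat}.
Local Notation V := 'rV[R]_n.

Definition dot (a v : V) : R := \sum_k a 0 k * v 0 k.

Lemma dot_linear (a : V) : linear (dot a : V -> R^o).
Proof.
move=> c u v; rewrite /dot scaler_sumr -big_split /=.
by apply: eq_bigr => k _; rewrite !mxE mulrDr mulrCA.
Qed.

HB.instance Definition _ (a : V) :=
  GRing.isLinear.Build R V R^o _ (dot a : V -> R^o) (dot_linear a).

Lemma dotC a b : dot a b = dot b a.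
Proof. by apply: eq_bigr => k _; rewrite mulrC. Qed.

Lemma dotDl a b v : dot (a + b) v = dot a v + dot b v.
Proof.
by rewrite /dot -big_split; apply: eq_bigr => k _; rewrite mxE mulrDl.
Qed.

Lemma dotZl c a v : dot (c *: a) v = c * dot a v.
Proof.
by rewrite /dot mulr_sumr; apply: eq_bigr => k _; rewrite mxE mulrA.
Qed.

Lemma dot0l v : dot 0 v = 0.
Proof. by rewrite -(scale0r 0) dotZl mul0r. Qed.

Lemma dot_delta a k : dot a (delta_mx 0 k) = a 0 k.
Proof.
rewrite /dot (bigD1 k) //= mxE !eqxx mulr1 big1 ?addr0 // => j jk.
by rewrite mxE eqxx (negbTE jk) mulr0.
Qed.

Lemma coord_le_norm (v : V) k : `|v 0 k| <= `|v|.
Proof.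
have /mapP[j Hj ->] : `|v 0 k| \in [seq `|v x.1 x.2| | x : 'I_1 * 'I_n].
  by apply/mapP; exists (0, k) => //=; rewrite mem_enum.
by rewrite [leRHS]/Num.Def.normr /= mx_normrE; apply/bigmax_geP; right => /=; exists j.
Qed.

Lemma norm_le_coord (v : V) e : 0 <= e -> (forall k, `|v 0 k| <= e) -> `|v| <= e.
Proof.
move=> e0 H; rewrite [leLHS]/Num.Def.normr /= mx_normrE; apply/bigmax_leP; split => //.
by case=> i j _ /=; rewrite ord1.
Qed.

Lemma dot_continuous a : continuous (dot a : V -> R^o).
Proof.
apply: continuous_big => [|k _ v]; first exact: add_continuous.
apply: (@continuousM R V (cst (a 0 k)) (fun v : V => v 0 k)).
  exact: cst_continuous.
exact: coord_continuous.
Qed.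

(** Differentiability from the estimate of the remainder; the gradient is
    given in coordinates because covectors on the manifold are. *)
Lemma differentiable_dot (f : V -> R^o) (x G : V) :
  (forall e, 0 < e -> \forall h \near (0 : V),
     `|f (h + x) - f x - dot G h| <= e * `|h|) ->
  is_diff x f (dot G).
Proof.
move=> H.
have E : f \o shift x = cst (f x) + (dot G : V -> R^o) +o_ (0 : V) id.
  apply/eqaddoP => e e0; have := H e e0; apply: filterS => h.
  by rewrite !fctE /= opprD addrA.
have D := diff_unique (@dot_continuous G) E.
by apply: DiffDef => //; apply/diff_locallyP; split; rewrite D//; exact: dot_continuous.
Qed.

Lemma line_derive (f : V -> R^o) x v (t : R) :
  derivable f (t *: v + x) v ->
  is_derive t (1 : R) (fun s : R => f (s *: v + x)) ('D_v f (t *: v + x)).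
Proof.
move=> dfx.
have E : (fun h : R => h^-1 *: (((fun s : R => f (s *: v + x)) \o shift t) (h *: (1 : R)) - f (t *: v + x)))
   = (fun h : R => h^-1 *: ((f \o shift (t *: v + x)) (h *: v) - f (t *: v + x))).
  apply/funext => h; do 3 f_equal; rewrite /= [h *: 1]mulr1 scalerDl addrA //.
split; first by rewrite /derivable E.
by rewrite /derive E.
Qed.

(** Mean value theorem for [s |-> f (s v + x)], in the form consumed by the
    coordinatewise telescoping of [partial_diff]. *)
Lemma line_mean_value (f : V -> R^o) x v (c e h : R) :
  (forall t : R, `|t| <= `|h| -> derivable f (t *: v + x) v /\
      `|'D_v f (t *: v + x) - c| <= e) ->
  `|f (h *: v + x) - f x - h * c| <= e * `|h|.
Proof.
move=> H.
pose phi s : R := f (s *: v + x).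
have phi0 : phi 0 = f x by rewrite /phi scale0r add0r.
have D (t : R) : `|t| <= `|h| -> is_derive t 1 phi ('D_v f (t *: v + x)).
  by move=> /H[? _]; exact: line_derive.
have main (a b : R) : a < b -> (forall s, s \in `[a, b] -> `|s| <= `|h|) ->
   exists2 c0, `|c0| <= `|h| & phi b - phi a = 'D_v f (c0 *: v + x) * (b - a).
  move=> ab abh.
  have [s sab E] : exists2 s, s \in `]a, b[ & phi b - phi a = 'D_v f (s *: v + x) * (b - a).
    apply: MVT => //.
      by move=> s sab; apply/D/abh; exact: subset_itv_oo_cc.
    apply: derivable_within_continuous => s sab.
    by have [] := D s (abh _ sab).
  by exists s => //; apply/abh; exact: subset_itv_oo_cc.
have [h0|h0|->] := ltgtP h 0; last by rewrite scale0r add0r subrr mul0r subrr normr0 mulr0.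
- have [s sh E] : exists2 c0, `|c0| <= `|h| & phi 0 - phi h = 'D_v f (c0 *: v + x) * (0 - h).
    apply: main => // s; rewrite in_itv /= => /andP[hs s0].
    by rewrite !ler0_norm // ?lerN2 // ltW.
  have -> : f (h *: v + x) - f x - h * c = ('D_v f (s *: v + x) - c) * h.
    rewrite -[f x]phi0 -/(phi h) -[phi h - _]opprB E; ring.
  by rewrite normrM ler_wpM2r //; case: (H s sh).
- have [s sh E] : exists2 c0, `|c0| <= `|h| & phi h - phi 0 = 'D_v f (c0 *: v + x) * (h - 0).
    apply: main => // s; rewrite in_itv /= => /andP[hs s0].
    by rewrite !ger0_norm // ltW.
  have -> : f (h *: v + x) - f x - h * c = ('D_v f (s *: v + x) - c) * h.
    rewrite -[f x]phi0 -/(phi h) E; ring.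
  by rewrite normrM ler_wpM2r //; case: (H s sh).
Qed.

Definition grad (f : V -> R) (x : V) : V :=
  \row_k 'D_(delta_mx 0 k) (f : V -> R^o) x.

Lemma near_coord (x : V) (P : V -> Prop) :
  (\forall y \near x, P y) <->
  exists2 d, 0 < d & forall y, `|y - x| < d -> P y.
Proof.
split.
  move=> /nbhs_normP[d d0 H]; exists d => // y yx; apply: H => /=.
  by rewrite /= distrC.
move=> [d d0 H]; apply/nbhs_normP; exists d => // y /= yx; apply: H.
by rewrite distrC.
Qed.

(** Moving from [x] to [x + h] one coordinate at a time, each step is
    controlled by the mean value theorem and by the continuity at [x] of the
    corresponding partial derivative. *)
Lemma partial_diff (f : V -> R^o) (x : V) :
  (\forall y \near x, forall k, derivable f y (delta_mx 0 k)) ->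
  (forall k, {for x, continuous ('D_(delta_mx 0 k) f)}) ->
  is_diff x f (dot (grad f x)).
Proof.
move=> df cf; apply: differentiable_dot => e e0.
pose e1 := e / n.+1%:R.
have e10 : 0 < e1 by rewrite divr_gt0.
have : \forall y \near x, forall k, derivable f y (delta_mx 0 k) /\
    `|'D_(delta_mx 0 k) f y - 'D_(delta_mx 0 k) f x| <= e1.
  have : \forall y \near x, forall k, `|'D_(delta_mx 0 k) f y - 'D_(delta_mx 0 k) f x| <= e1.
    apply: (@filter_forall _ _ (fun k y => `|'D_(delta_mx 0 k) f y - 'D_(delta_mx 0 k) f x| <= e1) (nbhs x)) => k.
    have /cvgrPdist_le /(_ _ e10) := cf k.
    by apply: filterS => y; rewrite distrC.
  by move: df; apply: filterS2 => y H1 H2 k; split.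
move=> /near_coord[d d0 Hd].
apply/near_coord; exists d => // h; rewrite subr0 => hd.
(* the increment restricted to its first [m] coordinates *)
pose part (m : nat) : V := \row_(j < n) (if (j < m)%N then h 0 j else 0).
have part0 : part 0%N = 0 by apply/rowP => j; rewrite !mxE.
have partn : part n = h by apply/rowP => j; rewrite !mxE ltn_ord.
have claim m : (m <= n)%N ->
  `|f (part m + x) - f x - \sum_(j < n | (j < m)%N) h 0 j * grad f x 0 j| <= e1 * m%:R * `|h|.
  elim: m => [_|m IH mn].
    by rewrite part0 add0r big_pred0 // subrr subr0 normr0 mulr0 mul0r.
  pose k := Ordinal mn.
  have partS : part m.+1 = h 0 k *: delta_mx 0 k + part m.
    apply/rowP => j; rewrite !mxE /= ltnS leq_eqVlt.
    rewrite -(inj_eq val_inj j k) /=.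
    case: eqP => [jm|_] /=; last by rewrite mulr0 add0r.
    by rewrite jm ltnn mulr1 addr0; congr (h 0 _); exact/val_inj.
  have S : \sum_(j < n | (j < m.+1)%N) h 0 j * grad f x 0 j =
      h 0 k * grad f x 0 k + \sum_(j < n | (j < m)%N) h 0 j * grad f x 0 j.
    rewrite (bigD1 k) /=; last by rewrite ltnSn.
    congr (_ + _); apply: eq_bigl => j; rewrite ltnS -(inj_eq val_inj j k) /=.
    by rewrite ltn_neqAle andbC.
  have step := @line_mean_value f (part m + x) (delta_mx 0 k) (grad f x 0 k) e1 (h 0 k).
  rewrite partS S -[X in f X]addrA.
  have {}step : `|f (h 0 k *: delta_mx 0 k + (part m + x)) - f (part m + x) -
     h 0 k * grad f x 0 k| <= e1 * `|h|.
    apply: le_trans (step _) _; last first.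
      by apply: ler_wpM2l; [exact: ltW | exact: coord_le_norm].
    move=> t th; rewrite [X in `|_ - X|]mxE; apply: Hd.
    rewrite addrA addrK; apply: le_lt_trans hd.
    apply: norm_le_coord => // j; rewrite !mxE /=.
    rewrite -(inj_eq val_inj j k) /=.
    case: eqP => [jm|_] /=.
      by rewrite jm ltnn mulr1 addr0 (le_trans th) // coord_le_norm.
    by rewrite mulr0 add0r; case: ifP => _; rewrite ?normr0 // coord_le_norm.
  have := le_trans (ler_normD _ _) (lerD step (IH (ltnW mn))).
  rewrite [X in _ <= X -> _](_ : _ = e1 * m.+1%:R * `|h|); last first.
    by rewrite -natr1; ring.
  apply: le_trans; rewrite le_eqVlt; apply/orP; left; apply/eqP.
  congr `|_|; ring.
have := claim n (leqnn n); rewrite partn /dot.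
rewrite [X in _ <= X -> _](_ : _ = e * `|h| * (n%:R / n.+1%:R)); last by rewrite /e1; ring.
have -> : \sum_(j < n | (j < n)%N) h 0 j * grad f x 0 j = \sum_k grad f x 0 k * h 0 k.
  by apply: eq_big => [j|j _]; rewrite ?ltn_ord // mulrC.
move=> /le_trans; apply.
by rewrite ler_piMr ?mulr_ge0 ?(ltW e0) // ler_pdivrMr // mul1r ler_nat.
Qed.

End C1Euclid.

(** * Calculus of continuous gradients *)

Section C1Calculus.
Context {R : realType} {n : nat}.
Local Notation V := 'rV[R]_n.
Implicit Types (O : set V) (f g : V -> R) (F G : V -> V).

(** The predicate [Ck_on 1] speaks of all directional derivatives; this
    form, equivalent to it on open sets, keeps track of an explicit
    gradient, which is what the Hamiltonian is evaluated at. *)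
Definition C1_grad O f G :=
  forall x, O x -> is_diff x (f : V -> R^o) (dot (G x) : V -> R^o) /\ {for x, continuous G}.

Lemma is_diff_dot_grad f (x a : V) :
  is_diff x (f : V -> R^o) (dot a : V -> R^o) -> grad f x = a.
Proof.
move=> fa; apply/rowP => k; rewrite mxE deriveE; last exact: ex_diff.
by rewrite diff_val dot_delta.
Qed.

Lemma Ck1_C1_grad O f : open O -> Ck_on 1 O (f : V -> R^o) -> C1_grad O f (grad f).
Proof.
move=> oO [df cf] x Ox; have D k : {for x, continuous ('D_(delta_mx 0 k) (f : V -> R^o))}.
  by apply: (cf (delta_mx 0 k)); rewrite inE.
split.
  apply: partial_diff => //.
  have : nbhs x O by exact: open_nbhs_nbhs.
  by apply: filterS => y Oy k; exact: df.
apply/(@cvgrPdist_le _ V _ (nbhs x)) => e e0.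
have : \forall y \near x, forall k, `|'D_(delta_mx 0 k) (f : V -> R^o) x - 'D_(delta_mx 0 k) (f : V -> R^o) y| <= e.
  apply: (@filter_forall _ _ (fun k y => `|'D_(delta_mx 0 k) (f : V -> R^o) x - 'D_(delta_mx 0 k) (f : V -> R^o) y| <= e) (nbhs x)) => k.
  by have /cvgrPdist_le /(_ _ e0) := D k.
move=> H; near=> y; apply: norm_le_coord => [|k]; first exact: ltW.
by rewrite !mxE; move: k; near: y; exact: H.
Unshelve. all: by end_near. Qed.

Lemma C1_grad_Ck1 O f G : open O -> C1_grad O f G -> Ck_on 1 O (f : V -> R^o).
Proof.
move=> oO fG; split.
  by move=> x v /fG[? _]; apply: diff_derivable; exact: ex_diff.
move=> v x; rewrite inE => Ox.
have E y : O y -> 'D_v (f : V -> R^o) y = dot (G y) v.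
  by move=> /fG[? _]; rewrite deriveE ?diff_val.
apply: (@cont_near_eq _ _ (dot v \o G)).
  have : nbhs x O by exact: open_nbhs_nbhs.
  by apply: filterS => y Oy; rewrite E //= dotC.
by apply: (@continuous_comp V V R^o G (dot v)); [case: (fG _ Ox)|exact: dot_continuous].
Qed.

Lemma C1_grad_eq O f G g F : C1_grad O f G -> (f =1 g) -> (forall x, O x -> \forall y \near x, G y = F y) -> C1_grad O g F.
Proof.
move=> fG fg GF x Ox; have [D C] := fG x Ox; have /nbhs_singleton GFx := GF x Ox.
split; first by have <- : f = g by [apply/funext => y; exact: fg]; rewrite -GFx.
exact: cont_near_eq (GF x Ox) C.
Qed.

(** Differentiability is local; needed because functions on the manifold
    read in two charts agree only on overlaps. *)
Lemma is_diff_near f g (x a : V) : (\forall y \near x, f y = g y) ->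
  is_diff x (f : V -> R^o) (dot a : V -> R^o) ->
  is_diff x (g : V -> R^o) (dot a : V -> R^o).
Proof.
move=> fg D; apply: differentiable_dot => e e0.
have Df : differentiable (f : V -> R^o) x by exact: ex_diff.
have /eqaddoP/(_ e e0) := diff_locally Df.
rewrite diff_val => H; near=> h.
have <- : f x = g x := nbhs_singleton fg.
have <- : f (h + x) = g (h + x).
  near: h; move/near_coord: fg => [d d0 fg]; apply/near_coord; exists d => // h hd.
  by apply: fg; rewrite addrK -[h]subr0.
by rewrite -addrA -opprD; near: h; exact: H.
Unshelve. all: by end_near. Qed.

Lemma C1_grad_cst O c : C1_grad O (fun=> c) (fun=> 0).
Proof.
move=> x _; split; last exact: cst_continuous.
apply: is_diff_eq (is_diff_cst (c : R^o) x) _.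
by apply/funext => v; rewrite dot0l.
Qed.

Lemma C1_gradD O f F g G : C1_grad O f F -> C1_grad O g G ->
  C1_grad O (fun x => f x + g x) (fun x => F x + G x).
Proof.
move=> fF gG x Ox; have [? ?] := fF x Ox; have [? ?] := gG x Ox.
split; last exact: continuousD.
apply: is_diff_eq (is_diffD _ _) _.
by apply/funext => v; rewrite dotDl.
Qed.

Lemma C1_gradZ O c f F : C1_grad O f F -> C1_grad O (fun x => c * f x) (fun x => c *: F x).
Proof.
move=> fF x Ox; have [? ?] := fF x Ox.
split; last by apply: continuousZ => //; exact: cst_continuous.
apply: is_diff_eq (is_diffZ c _) _.
by apply/funext => v; rewrite dotZl.
Qed.

Lemma C1_gradN O f F : C1_grad O f F -> C1_grad O (fun x => - f x) (fun x => - F x).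
Proof.
move=> /(C1_gradZ (-1)) H; apply: C1_grad_eq H _ _ => [x|x _]; first by rewrite mulN1r.
by near=> y; rewrite scaleN1r.
Unshelve. all: by end_near. Qed.

Lemma C1_gradB O f F g G : C1_grad O f F -> C1_grad O g G ->
  C1_grad O (fun x => f x - g x) (fun x => F x - G x).
Proof. by move=> fF gG; exact: (C1_gradD fF (C1_gradN gG)). Qed.

Lemma C1_gradM O f F g G : C1_grad O f F -> C1_grad O g G ->
  C1_grad O (fun x => f x * g x) (fun x => f x *: G x + g x *: F x).
Proof.
move=> fF gG x Ox; have [Df ?] := fF x Ox; have [Dg ?] := gG x Ox.
have cf : {for x, continuous f}.
  by apply: (@differentiable_continuous _ _ R^o); exact: ex_diff.
have cg : {for x, continuous g}.
  by apply: (@differentiable_continuous _ _ R^o); exact: ex_diff.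
split; last by apply: continuousD; apply: continuousZ.
apply: is_diff_eq (is_diffM Df Dg) _.
by apply/funext => v; rewrite dotDl !dotZl.
Qed.

Lemma C1_grad_comp O f F (h h' : R -> R) : C1_grad O f F ->
  (forall x, O x -> is_derive (f x) 1 h (h' (f x)) /\ {for f x, continuous h'}) ->
  C1_grad O (fun x => h (f x)) (fun x => h' (f x) *: F x).
Proof.
move=> fF hh x Ox; have [Df ?] := fF x Ox; have [Dh Ch] := hh x Ox.
have cf : {for x, continuous f}.
  by apply: (@differentiable_continuous _ _ R^o); exact: ex_diff.
split; last by apply: continuousZ => //; exact: (continuous_comp cf Ch).
have dh : is_diff (f x) (h : R^o -> R^o) (fun t => t * h' (f x)).
  have D : differentiable (h : R^o -> R^o) (f x) by apply/derivable1_diffP; exact: ex_derive.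
  apply: DiffDef => //; rewrite diff1E //; apply/funext => t.
  by rewrite derive1E derive_val.
apply: is_diff_eq (is_diff_comp Df dh) _.
by apply/funext => v; rewrite dotZl /= mulrC.
Qed.

Lemma C1_grad_dot O a : C1_grad O (dot a) (fun=> a).
Proof.
move=> x _; split; last exact: cst_continuous.
apply: differentiable_dot => e e0; near=> h.
by rewrite linearD /= addrK subrr normr0 mulr_ge0 // ltW.
Unshelve. all: by end_near. Qed.

Lemma C1_grad_coord O k : C1_grad O (fun x => x 0 k) (fun=> delta_mx 0 k).
Proof.
have Hd := @C1_grad_dot O (delta_mx 0 k).
apply: (C1_grad_eq Hd) => [x|x _]; first by rewrite /= dotC dot_delta.
by near=> y.
Unshelve. all: by end_near. Qed.

Lemma C1_grad_sum O (I : finType) (f : I -> V -> R) (F : I -> V -> V) :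
  (forall i, C1_grad O (f i) (F i)) ->
  C1_grad O (fun x => \sum_i f i x) (fun x => \sum_i F i x).
Proof.
move=> H.
have E : forall r : seq I, C1_grad O (fun x => \sum_(i <- r) f i x) (fun x => \sum_(i <- r) F i x).
  elim=> [|i r IH].
    apply: C1_grad_eq (@C1_grad_cst O 0) _ _ => [x|x _]; first by rewrite big_nil.
    by near=> y; rewrite big_nil.
  apply: C1_grad_eq (C1_gradD (H i) IH) _ _ => [x|x _]; first by rewrite big_cons.
  by near=> y; rewrite big_cons.
exact: E.
Unshelve. all: by end_near. Qed.

Definition sq (v : V) : R := dot v v.

Lemma C1_grad_sqB O y : C1_grad O (fun x => sq (x - y)) (fun x => 2 *: (x - y)).
Proof.
have H k : C1_grad O (fun x => (x 0 k - y 0 k) * (x 0 k - y 0 k))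
   (fun x => (x 0 k - y 0 k) *: (delta_mx 0 k - 0) + (x 0 k - y 0 k) *: (delta_mx 0 k - 0)).
  by apply: C1_gradM; apply: C1_gradB; (exact: C1_grad_coord || exact: C1_grad_cst).
apply: C1_grad_eq (C1_grad_sum H) _ _ => [x|x _].
  by rewrite /sq /dot; apply: eq_bigr => k _; rewrite !mxE.
near=> z; rewrite scaler_nat [z - y in RHS]row_sum_delta -sumrMnl.
by apply: eq_bigr => k _; rewrite subr0 mulr2n !mxE.
Unshelve. all: by end_near. Qed.

End C1Calculus.

(** A quadratic remainder identifies the derivative without any case
    distinction at the points where the formula for the function changes. *)
Lemma is_derive_quad (R : realType) (f : R -> R) (t c : R) :
  (forall h, `|f (h + t) - f t - h * c| <= h ^+ 2) -> is_derive t 1 f c.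
Proof.
move=> H.
have L : (fun h : R => h^-1 *: ((f \o shift t) (h *: (1 : R)) - f t)) @ 0^' --> c.
  apply/cvgrPdist_le => e e0; near=> h.
  have h0 : h != 0 by near: h; exact: nbhs_dnbhs_neq.
  have he : `|h| <= e by near: h; apply: dnbhs0_le.
  rewrite /= [h *: (1 : R)]mulr1 distrC.
  have -> : h^-1 *: (f (h + t) - f t) - c = h^-1 * (f (h + t) - f t - h * c).
    by rewrite [_ *: _]/(_ * _) [RHS]mulrBr mulKf.
  rewrite normrM normfV mulrC ler_pdivrMr ?normr_gt0 // (le_trans (H h)) //.
  by rewrite -real_normK ?num_real // expr2 ler_wpM2r.
split; first by apply/cvg_ex; exists c.
exact: cvg_lim L.
Unshelve. all: by end_near. Qed.

(** * The square of the positive part *)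

Section PosSquare.
Context {R : realType}.

(** The cutoffs and penalizations are built from this function: it is C^1,
    and vanishes on a half-line. *)
Definition pos_sq (t : R) : R := Num.max 0 t ^+ 2.

Lemma is_derive_pos_sq (t : R) : is_derive t (1 : R) pos_sq (2 * Num.max 0 t).
Proof.
apply: is_derive_quad => h; rewrite /pos_sq ler_norml.
have [t0|t0] := ltP t 0; have [h0|h0] := ltP (h + t) 0.
- by apply/andP; split; nra.
- by apply/andP; split; nra.
- by apply/andP; split; nra.
- by apply/andP; split; nra.
Qed.

Lemma continuous_max0 : continuous (fun t : R => Num.max 0 t : R).
Proof.
move=> t; apply: (@continuous_max R R (cst 0) id t); first exact: cst_continuous.
by [].
Qed.

End PosSquare.

(** * The Euclidean square norm *)

Section EuclidAnalysis.
Context {R : realType} {n : nat}.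
Local Notation V := 'rV[R]_n.

Lemma sq_ge0 (v : V) : 0 <= sq v.
Proof. by apply: sumr_ge0 => k _; rewrite -expr2 sqr_ge0. Qed.

Lemma coord_sq_le (v : V) k : v 0 k ^+ 2 <= sq v.
Proof.
rewrite /sq /dot (bigD1 k) //= expr2 lerDl.
by apply: sumr_ge0 => j _; rewrite -expr2 sqr_ge0.
Qed.

Lemma sq_eq0 (v : V) : sq v = 0 -> v = 0.
Proof.
move=> v0; apply/rowP => k; rewrite mxE; apply/eqP; rewrite -sqrf_eq0.
by rewrite eq_le sqr_ge0 -v0 coord_sq_le.
Qed.

Lemma sq0 : sq (0 : V) = 0.
Proof. by rewrite /sq dot0l. Qed.

Lemma norm_sq_le (v : V) : `|v| ^+ 2 <= sq v.
Proof.
have H : `|v| <= Num.sqrt (sq v).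
  apply: norm_le_coord; first exact: sqrtr_ge0.
  by move=> k; rewrite -sqrtr_sqr ler_sqrt ?sq_ge0 // coord_sq_le.
rewrite -[leRHS]sqr_sqrtr ?sq_ge0 //.
by rewrite ler_pXn2r // nnegrE ?normr_ge0 ?sqrtr_ge0.
Qed.

Lemma sq_norm_le (v : V) : sq v <= n%:R * `|v| ^+ 2.
Proof.
have -> : n%:R * `|v| ^+ 2 = \sum_(k < n) `|v| ^+ 2 by rewrite sumr_const card_ord mulr_natl.
apply: ler_sum => k _.
by rewrite -expr2 -real_normK ?num_real // ler_pXn2r ?nnegrE // coord_le_norm.
Qed.

Lemma sqN (v : V) : sq (- v) = sq v.
Proof. by rewrite /sq /dot; apply: eq_bigr => k _; rewrite mxE mulrNN. Qed.

Lemma sqBC (v w : V) : sq (v - w) = sq (w - v).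
Proof. by rewrite -sqN opprB. Qed.

Lemma sqZ c (v : V) : sq (c *: v) = c ^+ 2 * sq v.
Proof. by rewrite /sq dotZl [dot v _]dotC dotZl mulrA expr2. Qed.

Lemma continuous_sqB (y : V) : continuous (fun x : V => sq (x - y)).
Proof.
move=> x; have [D _] := @C1_grad_sqB R n setT y x I.
by apply: (@differentiable_continuous _ _ R^o); exact: ex_diff.
Qed.

Lemma continuous_sq : continuous (sq : V -> R).
Proof.
move=> x; have := @continuous_sqB 0 x.
by under eq_fun do rewrite subr0.
Qed.

Lemma compact_bclosed (B : set V) r : closed B -> (forall x, B x -> `|x| <= r) -> compact B.
Proof.
move=> cB H; apply: bounded_closed_compact => //.
exists r; split; first exact: num_real.
by move=> s rs x /H xr; exact: (le_trans xr (ltW rs)).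
Qed.

Lemma compact_cball (y : V) r : compact [set x | `|x - y| <= r].
Proof.
apply: (@compact_bclosed _ (`|y| + r)).
  apply: (@preimage_closed _ _ (fun x : V => `|x - y|) [set t | t <= r]).
    move=> x _; apply: continuous_comp; last exact: norm_continuous.
    by apply: continuousB => //; exact: cst_continuous.
  exact: closed_le.
move=> x /= H; rewrite -[x](subrK y) addrC.
by rewrite (le_trans (ler_normD _ _)) // lerD2l.
Qed.

Lemma compact_sqball (y : V) r : compact [set x | sq (x - y) <= r].
Proof.
apply: (@subclosed_compact _ _ [set x | `|x - y| <= Num.sqrt r]).
- apply: (@preimage_closed _ _ (fun x : V => sq (x - y)) [set t | t <= r]).
    by move=> x _; exact: continuous_sqB.
  exact: closed_le.
- exact: compact_cball.
- move=> x /= H; rewrite -[leLHS]ger0_norm // -sqrtr_sqr ler_wsqrtr //.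
  by rewrite (le_trans (norm_sq_le _)).
Qed.

End EuclidAnalysis.

(** * Doubling of variables and Lipschitz estimate in coordinates *)

Section Doubling.
Context {R : realType} {n : nat}.
Local Notation V := 'rV[R]_n.

(** The penalized function [a x + b y - phi x - |x - y0|^2 - K |x - y|^2]
    has a maximum on the compact square. As [K] tends to infinity, a cluster
    point of the maximum points lies on the diagonal, since the penalty
    stays bounded, and the term [|x - y0|^2] forces it to be [(y0, y0)].
    Freezing one of the variables gives two contacts whose [K]-dependent
    gradients are opposite to each other. *)
Lemma doubling (a b phi : V -> R) (y0 : V) (r : R) : 0 < r ->
  (forall y, `|y - y0| <= r -> [/\ {for y, continuous a}, {for y, continuous b}
     & {for y, continuous phi}]) ->
  (forall y, `|y - y0| <= r -> a y + b y <= phi y) -> a y0 + b y0 = phi y0 ->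
  forall e, 0 < e -> exists x y K, [/\ `|x - y0| < e, `|y - y0| < e,
    forall z, `|z - y0| <= r -> a z - phi z - sq (z - y0) - K * sq (z - y) <=
                                a x - phi x - sq (x - y0) - K * sq (x - y) &
    forall z, `|z - y0| <= r -> b z - K * sq (z - x) <= b y - K * sq (y - x)].
Proof.
move=> r0 cont abphi ab0 e e0.
pose B : set V := [set y | `|y - y0| <= r].
have cB : compact B by exact: compact_cball.
have By0 : B y0 by rewrite /B /= subrr normr0 ltW.
pose psi (p : V * V) : R := a p.1 + b p.2 - phi p.1 - sq (p.1 - y0).
pose d (p : V * V) : R := sq (p.1 - p.2).
have cd : continuous d.
  move=> p; apply: (@continuous_comp _ _ _ (fun p : V * V => p.1 - p.2) sq).
    by apply: continuousB; [exact: cvg_fst|exact: cvg_snd].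
  exact: continuous_sq.
have cpsi p : (B `*` B) p -> {for p, continuous psi}.
  move=> [/cont[ca _ cphi] /cont[_ cb _]].
  have c1 (h : V -> R) : {for p.1, continuous h} -> {for p, continuous (fun q : V * V => h q.1)}.
    exact: continuous_at_fst.
  have c2 (h : V -> R) : {for p.2, continuous h} -> {for p, continuous (fun q : V * V => h q.2)}.
    exact: continuous_at_snd.
  apply: continuousB; last by apply: (c1 (fun x => sq (x - y0))); exact: continuous_sqB.
  apply: continuousB; last exact: c1.
  by apply: continuousD; [exact: c1|exact: c2].
have EX K : exists p, (B `*` B) p /\ forall q, (B `*` B) q -> psi q - K * d q <= psi p - K * d p.
  have [||p pB pm] := @compact_EVT_max _ R (fun q => psi q - K * d q) _ _ (compact_setX cB cB).
  - by exists (y0, y0).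
  - apply: continuous_in_subspaceT => q; rewrite inE => Bq.
    apply: continuousB; first exact: cpsi.
    by apply: continuousM; [exact: cst_continuous|exact: cd].
  exists p; split; first by rewrite inE in pB.
  by move=> q Bq; apply: pm; rewrite inE.
have [pf pfP] := choice EX.
have psi_ge K : K * d (pf K) <= psi (pf K).
  have [_ /(_ (y0, y0))] := pfP K.
  rewrite /psi /d /= !subrr sq0 mulr0 !subr0 ab0 subrr => H.
  by rewrite -subr_ge0; apply: H.
pose C := psi (pf 0).
have psi_le q : (B `*` B) q -> psi q <= C.
  by move=> Bq; have [_ /(_ q Bq)] := pfP 0; rewrite !mul0r !subr0.
have d0 q : 0 <= d q by exact: sq_ge0.
have [|[X Y] [[BX BY] cl]] := compact_setX cB cB (F := pf @ +oo).
  by rewrite /nbhs /=; apply: (@filterE _ (pinfty_nbhs R)) => K; case: (pfP K).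
have XY : X = Y.
  apply/eqP; rewrite -subr_eq0; apply/eqP/sq_eq0/eqP; rewrite eq_le sq_ge0 andbT.
  rewrite leNgt; apply/negP => s0.
  have N : \forall p \near (X, Y), sq (X - Y) / 2 < d p.
    by apply: near_gt; [exact: cd|rewrite /d /=; lra].
  have Q : \forall K \near pinfty_nbhs R, `|C| / (sq (X - Y) / 2) < K /\ 0 < K.
    by near=> K; split; near: K; (apply: nbhs_pinfty_gt; exact: num_real).
  have [K [K1 K0] K2] := cluster_near _ cl N Q.
  move: K1; rewrite ltr_pdivrMr ?divr_gt0 // => K1.
  have := psi_le _ (pfP K).1; have := psi_ge K; have := ler_norm C.
  have : K * (sq (X - Y) / 2) < K * d (pf K) by rewrite ltr_pM2l.
  by move: (C) (psi _) (d _) K1 => *; lra.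
subst Y.
(* on the diagonal [a + b <= phi], so only the term [- |X - y0|^2] is left *)
have X0 : X = y0.
  apply/eqP; rewrite -subr_eq0; apply/eqP/sq_eq0/eqP; rewrite eq_le sq_ge0 andbT.
  have m0 := abphi _ BX.
  have : 0 <= psi (X, X).
    rewrite leNgt; apply/negP => s0.
    have N : \forall p \near (X, X), psi p < 0.
      by apply: near_lt => //; exact: cpsi.
    have Q : \forall K \near pinfty_nbhs R, (0 : R) < K by apply: nbhs_pinfty_gt; exact: num_real.
    have [K K0 K2] := cluster_near _ cl N Q.
    by have := le_lt_trans (psi_ge K) K2; rewrite ltNge mulr_ge0 // ltW.
  by rewrite /psi /=; lra.
subst X.
have N : \forall p \near (y0, y0), `|p.1 - y0| < e /\ `|p.2 - y0| < e.
  exists ([set y | `|y - y0| < e], [set y | `|y - y0| < e]) => //=.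
  by split; apply/near_coord; exists e.
have Q : \forall K \near pinfty_nbhs R, (0 : R) < K by apply: nbhs_pinfty_gt; exact: num_real.
have [K K0 [K1 K2]] := cluster_near _ cl N Q.
have [[B1 B2] H] := pfP K.
exists (pf K).1, (pf K).2, K; split => // z Bz.
  have := H (z, (pf K).2) (conj Bz B2); rewrite /psi /d /=; lra.
have := H ((pf K).1, z) (conj B1 Bz); rewrite /psi /d /=.
rewrite [sq (z - _)]sqBC [sq ((pf K).2 - _)]sqBC; lra.
Unshelve. all: by end_near. Qed.

(** Compare [a] with [2 C sqrt (eta^2 + |x - y|^2)], whose gradient is
    longer than [C] as soon as [|x - y| > eta], plus a term that is zero for
    [|x - y|^2 <= rho / 2] and so large at the boundary that the maximum of
    the difference is interior. Then the maximum is attained for [|x - y| <=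
    eta], where [a] is close to [a y]; let [eta] tend to 0. The penalty also
    has its gradient along [x - y], so it cannot cancel the main one. *)
Lemma lipschitz_of_supergradient (O : set V) (a : V -> R) (y : V) (C rho : R) :
  0 < C -> 0 < rho ->
  (forall x, sq (x - y) <= rho -> {for x, continuous a}) ->
  (forall x phi G, sq (x - y) < rho -> C1_grad setT phi G ->
     (\forall z \near x, a z <= phi z) -> a x = phi x -> sq (G x) <= C ^+ 2) ->
  forall x, sq (x - y) <= rho / 2 -> a x <= a y + 2 * C * Num.sqrt (sq (x - y)).
Proof.
move=> C0 rho0 ca grada x0 x0rho.
pose B : set V := [set x | sq (x - y) <= rho].
have cB : compact B by exact: compact_sqball.
have By : B y by rewrite /B /= subrr sq0 ltW.
have caB : {within B, continuous a}.
  by apply: continuous_in_subspaceT => x; rewrite inE; exact: ca.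
have [M HM] : exists M, forall x, B x -> `|a x| <= M.
  have [||p _ pm] := @compact_EVT_max _ R a B _ cB; [by exists y|by []|].
  have [||q _ qm] := @compact_EVT_min _ R a B _ cB; [by exists y|by []|].
  exists (`|a p| + `|a q|) => x Bx.
  have := pm x (mem_set Bx); have := qm x (mem_set Bx).
  have := ler_norm (a p); have := ler_norm (- a q); rewrite normrN => h1 h2 h3 h4.
  have := normr_ge0 (a p); have := normr_ge0 (a q).
  by move=> *; rewrite ler_norml; apply/andP; split; lra.
apply/ler_addgt0Pr => e e0.
have [eta eta0 Heta] : exists2 eta, 0 < eta & forall x, sq (x - y) <= eta ^+ 2 -> a x <= a y + e.
  have : \forall x \near y, a x < a y + e.
    by apply: near_lt; [apply: ca; exact: By|rewrite ltrDl].
  move=> /near_coord[d d0 H]; exists (d / 2); first by rewrite divr_gt0.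
  move=> x xd; apply/ltW/H; have : `|x - y| <= d / 2.
    rewrite -(@ler_pXn2r _ 2) ?nnegrE ?divr_ge0 ?(ltW d0) //.
    exact: le_trans (norm_sq_le _) xd.
  by move=> /le_lt_trans; apply; lra.
(* on the boundary of the ball the penalty is larger than the oscillation
   of [a] *)
pose T := (2 * M + 1) / (rho / 2) ^+ 2.
have M0 : 0 <= M by apply: le_trans (HM y By).
have T0 : 0 < T by rewrite divr_gt0 ?exprn_gt0 ?divr_gt0 //; lra.
pose h (s : R) : R := 2 * C * Num.sqrt (eta ^+ 2 + s) + T * pos_sq (s - rho / 2).
pose h' (s : R) : R := 2 * C * (2 * Num.sqrt (eta ^+ 2 + s))^-1 +
   T * (2 * Num.max 0 (s - rho / 2)).
pose phi x := h (sq (x - y)).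
have eta2 : 0 < eta ^+ 2 by rewrite exprn_gt0.
have hh x : is_derive (sq (x - y)) 1 h (h' (sq (x - y))) /\ {for sq (x - y), continuous h'}.
  have s0 : 0 < eta ^+ 2 + sq (x - y) by rewrite ltr_pwDl // sq_ge0.
  split.
    have D1 : is_derive (sq (x - y)) 1 (fun s : R => eta ^+ 2 + s) (0 + 1).
      by apply: is_deriveD.
    have D2 : is_derive (sq (x - y)) 1 (fun s : R => s - rho / 2) (1 - 0).
      by apply: is_deriveB.
    have D3 := is_derive1_comp (is_derive1_sqrt s0) D1.
    have D4 := @is_derive1_comp _ pos_sq (fun s : R => s - rho / 2) _ _ _
      (@is_derive_pos_sq R (sq (x - y) - rho / 2)) D2.
    have := is_deriveD (is_deriveZ (2 * C) D3) (is_deriveZ T D4).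
    move=> D; apply: is_derive_eq D _.
    by rewrite /h' add0r subr0 !mulr1.
  apply: continuousD.
    apply: continuousM; first exact: cst_continuous.
    apply: continuousV.
      by rewrite mulf_neq0 // gt_eqF // sqrtr_gt0.
    apply: continuousM; first exact: cst_continuous.
    apply: (@continuous_comp _ _ _ (fun s : R => eta ^+ 2 + s) Num.sqrt); last exact: sqrt_continuous.
    exact: continuous_shiftl.
  apply: continuousM; first exact: cst_continuous.
  apply: continuousM; first exact: cst_continuous.
  apply: (@continuous_comp _ _ _ (fun s : R => s - rho / 2) (fun t => Num.max 0 t)); last exact: continuous_max0.
  exact: continuous_shiftr.
have phiC1 : C1_grad setT phi (fun x => h' (sq (x - y)) *: (2 *: (x - y))).
  by apply: (C1_grad_comp (C1_grad_sqB _)) => x _; exact: hh.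
have [||xm xmB xmax] := @compact_EVT_max _ R (fun x => a x - phi x) B _ cB.
- by exists y.
- apply: continuous_in_subspaceT => x; rewrite inE => Bx.
  apply: continuousB; first exact: ca.
  have [D _] := phiC1 x I.
  by apply: (@differentiable_continuous _ _ R^o); exact: ex_diff.
rewrite inE in xmB.
have hge s : 0 <= s -> 2 * C * eta <= h s.
  move=> s0; rewrite /h -[leLHS]addr0 lerD //.
    rewrite ler_pM2l ?mulr_gt0 // -{1}[eta]gtr0_norm // -sqrtr_sqr ler_wsqrtr //.
    by rewrite lerDl.
  by rewrite mulr_ge0 ?(ltW T0) // sqr_ge0.
have phiy : phi y = 2 * C * eta.
  rewrite /phi /h subrr sq0 addr0 sqrtr_sqr gtr0_norm //.
  by rewrite /pos_sq max_l ?expr0n ?mulr0 ?addr0 //; lra.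
have amy := xmax _ (mem_set By).
have inner : sq (xm - y) < rho.
  rewrite lt_neqAle xmB andbT; apply/eqP => E.
  have : 2 * C * eta + (2 * M + 1) <= phi xm.
    rewrite /phi /h E /pos_sq lerD //.
      rewrite ler_pM2l ?mulr_gt0 // -{1}[eta]gtr0_norm // -sqrtr_sqr ler_wsqrtr //.
      by rewrite lerDl ltW.
    have -> : rho - rho / 2 = rho / 2 by lra.
    rewrite max_r; last by lra.
    by rewrite /T divfK // gt_eqF // exprn_gt0 //; lra.
  have := HM _ By; have := HM _ xmB; rewrite !ler_norml => /andP[_ ?] /andP[? _].
  by move: amy; rewrite phiy; lra.
have near_y : sq (xm - y) <= eta ^+ 2.
  rewrite leNgt; apply/negP => far.
  have : sq (h' (sq (xm - y)) *: (2 *: (xm - y))) <= C ^+ 2.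
  apply: (grada xm (fun x => phi x + (a xm - phi xm)) (fun x => h' (sq (x - y)) *: (2 *: (x - y))) inner).
  - apply: C1_grad_eq (C1_gradD phiC1 (@C1_grad_cst R n setT (a xm - phi xm))) _ _ => // x _.
    by near=> z; rewrite addr0.
  - have : \forall z \near xm, sq (z - y) < rho.
      by apply: (@near_lt R V (fun z => sq (z - y)) xm rho _ inner); exact: continuous_sqB.
    apply: filterS => z zr.
    by have := xmax _ (mem_set (ltW zr : B z)) => ?; lra.
  - by rewrite addrC subrK.
  rewrite !sqZ; apply/negP; rewrite -ltNge.
  set s := sq (xm - y); have s0 : 0 < s by apply: lt_trans far.
  have q0 : 0 < Num.sqrt (eta ^+ 2 + s) by rewrite sqrtr_gt0 addr_gt0.
  have H1 : 2 * C * (2 * Num.sqrt (eta ^+ 2 + s))^-1 <= h' s.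
    by rewrite lerDl mulr_ge0 ?(ltW T0) // mulr_ge0 // le_max lexx.
  have H2 : 0 < 2 * C * (2 * Num.sqrt (eta ^+ 2 + s))^-1.
    by rewrite !mulr_gt0 // invr_gt0 mulr_gt0.
  have H3 : (2 * C * (2 * Num.sqrt (eta ^+ 2 + s))^-1) ^+ 2 * (2 ^+ 2 * s) <=
     h' s ^+ 2 * (2 ^+ 2 * s).
    rewrite ler_pM2r ?mulr_gt0 //.
    by rewrite ler_pXn2r ?nnegrE // ltW // (lt_le_trans H2).
  apply: lt_le_trans H3.
  have -> : (2 * C * (2 * Num.sqrt (eta ^+ 2 + s))^-1) ^+ 2 * (2 ^+ 2 * s) =
     C ^+ 2 * (4 * s / (eta ^+ 2 + s)).
    have qq : eta ^+ 2 + s = Num.sqrt (eta ^+ 2 + s) ^+ 2.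
      by rewrite sqr_sqrtr // ltW // addr_gt0.
    rewrite [in X in _ = X]qq; move: q0; set q := Num.sqrt _ => q0.
    by field; rewrite gt_eqF.
  rewrite ltr_pMr ?exprn_gt0 // ltr_pdivlMr ?addr_gt0 // mul1r.
  by move: far; rewrite -/s; lra.
have Bx0 : B x0 by rewrite /B /=; lra.
have := xmax _ (mem_set Bx0); have := Heta _ near_y; have := hge _ (sq_ge0 (xm - y)).
rewrite -/(phi xm).
have : phi x0 <= 2 * C * eta + 2 * C * Num.sqrt (sq (x0 - y)).
  rewrite /phi /h /pos_sq max_l; last by lra.
  rewrite expr0n /= mulr0 addr0 -mulrDr ler_pM2l ?mulr_gt0 //.
  have q0 : 0 <= Num.sqrt (sq (x0 - y)) by exact: sqrtr_ge0.
  rewrite -[in leLHS](@sqr_sqrtr _ (sq (x0 - y))) ?sq_ge0 //.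
  move: q0; set q := Num.sqrt _ => q0.
  rewrite -[leRHS]ger0_norm ?addr_ge0 ?(ltW eta0) // -sqrtr_sqr ler_wsqrtr //.
  by nra.
by lra.
Unshelve. all: by end_near. Qed.

End Doubling.

(** * Gradients of locally defined functions *)

Section VectorCalculus.
Context {R : realType} {n : nat}.
Local Notation V := 'rV[R]_n.

Lemma diff_rV (f : V -> V) (x : V) :
  (forall k, differentiable (fun y => f y 0 k : R^o) x) -> differentiable f x.
Proof.
move=> H; rewrite (_ : f = \sum_(k < n) (fun y => (f y 0 k) *: (delta_mx 0 k : V))).
  by apply: differentiable_sum => k; apply: (@differentiableZl _ _ _ (fun y => f y 0 k)).
apply/funext => y; rewrite [LHS]row_sum_delta.
by elim/big_ind2: _ => // ? ? ? ? -> ->.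
Qed.

Lemma dot_suml (I : finType) (F : I -> V) v : dot (\sum_k F k) v = \sum_k dot (F k) v.
Proof. by apply: (big_morph (fun a => dot a v)) => [a b|]; rewrite ?dotDl ?dot0l. Qed.

(** A function is C^1 as soon as it agrees, near each point, with a function
    whose gradient is known. *)
Lemma C1_grad_intro (O : set V) (f : V -> R) :
  (forall y, O y -> exists U1 g F, [/\ open U1, U1 y, C1_grad U1 g F & forall z, U1 z -> f z = g z]) ->
  C1_grad O f (grad f).
Proof.
move=> H y Oy; have [U1 [g [F [oU1 U1y gF fg]]]] := H y Oy.
have nO z : U1 z -> \forall w \near z, U1 w by move=> ?; exact: open_nbhs_nbhs.
have D z : U1 z -> is_diff z (f : V -> R^o) (dot (F z) : V -> R^o).
  move=> Oz; apply: is_diff_near (gF z Oz).1.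
  by apply: filterS (nO _ Oz) => w Ow; rewrite fg.
have E z : U1 z -> F z = grad f z by move=> /D/is_diff_dot_grad ->.
split; first by rewrite -E //; exact: D.
apply: cont_near_eq (gF y U1y).2.
by apply: filterS (nO _ U1y) => z; exact: E.
Qed.

Lemma C1_grad_subset (O U1 : set V) f G : U1 `<=` O -> C1_grad O f G -> C1_grad U1 f G.
Proof. by move=> OO fG x /OO/fG. Qed.

(** Fermat's rule; testing with the increment [- t a] gives [|a|^2 <= e |a|]
    for every [e > 0]. *)
Lemma grad_at_min (f : V -> R) (y a : V) :
  is_diff y (f : V -> R^o) (dot a : V -> R^o) -> (\forall z \near y, f y <= f z) ->
  a = 0.
Proof.
move=> D fm; apply: sq_eq0; apply/eqP; rewrite eq_le sq_ge0 andbT.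
apply/ler_addgt0Pr => e e0; rewrite add0r.
have Df : differentiable (f : V -> R^o) y by exact: ex_diff.
pose e1 := e / (`|a| + 1).
have a1 : 0 < `|a| + 1 by rewrite ltr_wpDl.
have e10 : 0 < e1 by rewrite divr_gt0.
have /eqaddoP/(_ e1 e10)/near_coord[d d0] := diff_locally Df.
rewrite diff_val => H; move/near_coord: fm => [d' d'0 fm].
pose t := Num.min d d' / (`|a| + 1) / 2.
have m0 : 0 < Num.min d d' by rewrite lt_min d0.
have t0 : 0 < t by rewrite !divr_gt0.
have tm : `|- t *: a| < Num.min d d'.
  rewrite normrZ normrN gtr0_norm // /t -[_ / 2]mulrA -invfM -mulrA gtr_pMr // mulrC.
  rewrite ltr_pdivrMr ?mulr_gt0 // mul1r.
  by have := normr_ge0 a; lra.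
have [td td'] : `|- t *: a| < d /\ `|- t *: a| < d' by move: tm; rewrite lt_min => /andP[].
have := H (- t *: a); rewrite subr0 => /(_ td).
have := fm (- t *: a + y); rewrite addrK => /(_ td') fmt.
rewrite !fctE /= => H1.
have : - dot a (- t *: a) <= e1 * `|- t *: a|.
  by apply: le_trans H1; rewrite ler_normr; apply/orP; left; lra.
rewrite dotC dotZl -/(sq a) normrZ normrN gtr0_norm // mulNr opprK mulrCA ler_pM2l //.
move=> /le_trans; apply; rewrite /e1 -mulrA ger_pMr // mulrC ler_pdivrMr // mul1r.
by rewrite lerDl.
Qed.

End VectorCalculus.

(** * Differentials on the manifold, read in charts *)

Section ChartCalculus.
Context {R : realType} {n : nat} {M : topologicalType} (A : smooth_atlas R n M).
Local Notation V := 'rV[R]_n.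
Implicit Types (i j : chart_index A) (x : M) (y : V) (phi psi : M -> R).

Lemma chartE i x : chart_dom i x -> chart_inv i (chart i x) = x.
Proof. by move=> xi; apply: chartK; rewrite inE. Qed.

Lemma chart_imgP i x : chart_dom i x -> chart_img i (chart i x).
Proof. by move=> xi; exists x. Qed.

Lemma chart_inv_dom i y : chart_img i y -> chart_dom i (chart_inv i y).
Proof. by move=> [x xi <-]; rewrite chartE. Qed.

Lemma chart_invK i y : chart_img i y -> chart i (chart_inv i y) = y.
Proof. by move=> [x xi <-]; rewrite chartE. Qed.

Lemma chart_inv_cont i y : chart_img i y -> {for y, continuous (chart_inv i)}.
Proof. by move=> iy; apply: chart_inv_continuous; rewrite inE. Qed.

Lemma chart_cont i x : chart_dom i x -> {for x, continuous (chart i)}.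
Proof. by move=> xi; apply: chart_continuous; rewrite inE. Qed.

Lemma open_chart_preimage i (B : set M) : open B ->
  open [set y | chart_img i y /\ B (chart_inv i y)].
Proof.
move=> oB; rewrite openE => y [iy By].
have H1 : nbhs y (chart_img i) by apply: open_nbhs_nbhs; split => //; exact: chart_img_open.
have H2 : nbhs y (chart_inv i @^-1` B).
  by apply: (chart_inv_cont iy); exact: open_nbhs_nbhs.
by apply: filterS2 H1 H2 => z.
Qed.

(** The domain of the transition map, in a form that is visibly open. *)
Definition overlap i j := [set y : V | chart_img i y /\ chart_dom j (chart_inv i y)].

Lemma overlapE i j : overlap i j = chart i @` (chart_dom i `&` chart_dom j).
Proof.
apply/seteqP; split=> y.
  move=> [[x xi <-]]; rewrite chartE // => xj; exists x => //.
by move=> [x [xi xj] <-]; split; rewrite ?chartE //; exact: chart_imgP.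
Qed.

Lemma open_overlap i j : open (overlap i j).
Proof. by apply: open_chart_preimage; exact: chart_dom_open. Qed.

Definition transition i j : V -> V := chart j \o chart_inv i.

Lemma transition_C1_grad i j k : C1_grad (overlap i j) (fun y => transition i j y 0 k) (grad (fun y => transition i j y 0 k)).
Proof.
have [Ds Cs] := @chart_transition_smooth _ _ _ A i j 1%N.
rewrite -overlapE in Ds Cs.
apply: Ck1_C1_grad; first exact: open_overlap.
have D v y : overlap i j y -> derivable (fun y => transition i j y 0 k : R^o) y v.
  by move=> ijy; have /derivable_mxP := Ds y v ijy; exact.
split=> [y v /D //|v y].
rewrite inE => ijy; apply: (@cont_near_eq _ _ (fun z => 'D_v (transition i j) z 0 k)).
  have : nbhs y (overlap i j) by apply: open_nbhs_nbhs; split => //; exact: open_overlap.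
  by apply: filterS => z zij; rewrite derive_mx ?mxE //; exact: Ds.
apply: (@continuous_comp _ _ _ ('D_v (transition i j)) (fun w : V => w 0 k)); last exact: coord_continuous.
by apply: Cs; rewrite inE.
Qed.

Lemma transition_diff i j y : overlap i j y -> differentiable (transition i j) y.
Proof.
by move=> ijy; apply: diff_rV => k; have [D _] := @transition_C1_grad i j k y ijy; exact: ex_diff.
Qed.

Lemma diff_transitionE i j y v : overlap i j y ->
  'd (transition i j) y v = \row_k dot (grad (fun y => transition i j y 0 k) y) v.
Proof.
move=> ijy; rewrite -deriveE; last exact: transition_diff.
rewrite derive_mx; last exact/diff_derivable/transition_diff.
apply/rowP => k; rewrite !mxE; have [D _] := @transition_C1_grad i j k y ijy.
by rewrite deriveE ?diff_val //; exact: ex_diff.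
Qed.

Lemma transition_img i j y : overlap i j y -> chart_img j (transition i j y).
Proof. by move=> [_ yj]; exact: chart_imgP. Qed.

Lemma transition_inv i j y : overlap i j y -> chart_inv j (transition i j y) = chart_inv i y.
Proof. by move=> [_ yj]; rewrite /transition /= chartE. Qed.

Lemma comp_transition_diff i j y (h : V -> R) (a : V) : overlap i j y ->
  is_diff (transition i j y) (h : V -> R^o) (dot a : V -> R^o) ->
  is_diff y (h \o transition i j : V -> R^o)
    (dot (\sum_k a 0 k *: grad (fun y => transition i j y 0 k) y) : V -> R^o).
Proof.
move=> ijy Dh.
apply: is_diff_eq (is_diff_comp (differentiableP (transition_diff ijy)) Dh) _.
apply/funext => v /=; rewrite diff_transitionE //.
by rewrite dot_suml; apply: eq_bigr => k _; rewrite mxE dotZl.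
Qed.

Lemma comp_transition_C1_grad i j (h : V -> R) (F : V -> V) : C1_grad (chart_img j) h F ->
  C1_grad (overlap i j) (h \o transition i j)
    (fun y => \sum_k F (transition i j y) 0 k *: grad (fun y => transition i j y 0 k) y).
Proof.
move=> hF y ijy; have [Dh Ch] := hF _ (transition_img ijy).
split; first exact: comp_transition_diff.
apply: continuous_at_sum => k.
have [_ ?] := @transition_C1_grad i j k y ijy.
apply: continuousZ => //.
have ct : {for y, continuous (transition i j)}.
  exact/differentiable_continuous/transition_diff.
apply: (@continuous_comp _ _ _ (F \o transition i j) (fun w : V => w 0 k)); last exact: coord_continuous.
exact: continuous_comp.
Qed.

Lemma C1_C1_grad phi i : C1 A phi -> C1_grad (chart_img i) (phi \o chart_inv i) (grad (phi \o chart_inv i)).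
Proof. by move=> /(_ i) Cphi; apply: Ck1_C1_grad => //; exact: chart_img_open. Qed.

(** Covectors are bundled linear maps; two of them are equal when they agree
    as functions because the proofs of linearity are irrelevant. *)
Lemma cotangent_ext x (p q : cotangent A x) : (forall v, p v = q v) -> p = q.
Proof.
case: p q => [p cp] [q cq] /= pq.
have {pq} E : p = q by apply/funext.
subst q; f_equal.
case: cp => -[a1] [a2]; case: cq => -[b1] [b2].
by rewrite (Prop_irrelevance a1 b1) (Prop_irrelevance a2 b2).
Qed.

Lemma covecE i x a (v : tangent A x) : covec i x a v = dot a (v i) :> R.
Proof. by []. Qed.

Lemma tangent_transition i j x (v : tangent A x) : chart_dom i x -> chart_dom j x ->
  v j = 'd (transition i j) (chart i x) (v i).
Proof. by case: v => v /= /asboolP[H _] xi xj; exact: H. Qed.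

Lemma overlap_chart i j x : chart_dom i x -> chart_dom j x -> overlap i j (chart i x).
Proof. by move=> xi xj; split; rewrite ?chartE //; exact: chart_imgP. Qed.

Lemma transitionE i j x : chart_dom i x -> transition i j (chart i x) = chart j x.
Proof. by move=> xi; rewrite /transition /= chartE. Qed.

Lemma chart_atP x : chart_dom (chart_at A x) x.
Proof. by rewrite /chart_at; case: cid. Qed.

Lemma nbhs_overlap i j y : overlap i j y -> \forall z \near y, overlap i j z.
Proof. by move=> ijy; apply: open_nbhs_nbhs; split => //; exact: open_overlap. Qed.

(** The chain rule: the differential, defined through a fixed chart at [x],
    has the coordinates of the gradient in any chart around [x]. *)
Lemma dman_covec phi x i : C1 A phi -> chart_dom i x ->
  dman A phi x = covec i x (grad (phi \o chart_inv i) (chart i x)).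
Proof.
move=> Cphi xi; apply: cotangent_ext => v.
rewrite covecE /dman /= /dman_fun.
set c := chart_at A x; have xc : chart_dom c x by exact: chart_atP.
have Oy := overlap_chart xi xc.
rewrite (tangent_transition v xi xc).
have [Dc _] := C1_C1_grad Cphi (chart_imgP xc).
have [Di _] := C1_C1_grad Cphi (chart_imgP xi).
have := Dc; rewrite -(transitionE (i:=i) c xi) => /(comp_transition_diff Oy) Dt.
have E : \forall z \near chart i x, ((phi \o chart_inv c) \o transition i c) z = (phi \o chart_inv i) z.
  by apply: filterS (nbhs_overlap Oy) => z /transition_inv; rewrite /= => ->.
have := is_diff_dot_grad (is_diff_near E Dt) => ->.
rewrite transitionE // diff_val diff_transitionE //.
rewrite dot_suml; apply: eq_bigr => k _; by rewrite mxE dotZl.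
Qed.

End ChartCalculus.

(** * A compactly supported function with a strict maximum *)

Section Bump.
Context {R : realType} {n : nat}.
Local Notation V := 'rV[R]_n.

Lemma sq_near (y : V) (P : V -> Prop) : (\forall z \near y, P z) ->
  exists2 r, 0 < r & forall z, sq (z - y) <= r -> P z.
Proof.
move=> /near_coord[d d0 H]; exists ((d / 2) ^+ 2); first by rewrite exprn_gt0 // divr_gt0.
move=> z zy; apply: H; have : `|z - y| <= d / 2.
  rewrite -(@ler_pXn2r _ 2) ?nnegrE ?divr_ge0 ?(ltW d0) //.
  exact: le_trans (norm_sq_le _) zy.
by move=> /le_lt_trans; apply; lra.
Qed.

Definition hat (y0 : V) (r : R) (y : V) : R := pos_sq (1 - r^-1 * sq (y - y0)).

Definition hat_grad (y0 : V) (r : R) (y : V) : V :=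
  (2 * Num.max 0 (1 - r^-1 * sq (y - y0))) *: (0 - r^-1 *: (2 *: (y - y0))).

Lemma C1_grad_hat O y0 r : C1_grad O (hat y0 r) (hat_grad y0 r).
Proof.
apply: (@C1_grad_comp _ _ _ (fun y => 1 - r^-1 * sq (y - y0)) _ pos_sq (fun t => 2 * Num.max 0 t)).
  by apply: C1_gradB; [exact: C1_grad_cst|apply: C1_gradZ; exact: C1_grad_sqB].
move=> x _; split; first exact: is_derive_pos_sq.
by apply: continuousM; [exact: cst_continuous|exact: continuous_max0].
Qed.

Lemma hat_center y0 r : hat y0 r y0 = 1.
Proof. by rewrite /hat subrr sq0 mulr0 subr0 /pos_sq max_r // expr1n. Qed.

Lemma hat_grad_center y0 r : hat_grad y0 r y0 = 0.
Proof. by rewrite /hat_grad subrr !scaler0 subr0 scaler0. Qed.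

Lemma hat_ge0 y0 r y : 0 <= hat y0 r y.
Proof. exact: sqr_ge0. Qed.

Lemma hat_le1 y0 r y : 0 < r -> hat y0 r y <= 1.
Proof.
move=> r0; rewrite /hat /pos_sq expr_le1 // ?le_max ?lexx // ge_max ler01 /=.
by rewrite gerBl mulr_ge0 ?invr_ge0 ?(ltW r0) ?sq_ge0.
Qed.

Lemma hat_lt1 y0 r y : 0 < r -> y != y0 -> hat y0 r y < 1.
Proof.
move=> r0 yy0; rewrite /hat /pos_sq expr_lt1 // ?le_max ?lexx // gt_max ltr01 /=.
rewrite gtrBl mulr_gt0 ?invr_gt0 // lt_neqAle sq_ge0 andbT eq_sym.
by apply: contra yy0 => /eqP/sq_eq0/eqP; rewrite subr_eq0.
Qed.

Lemma hat_eq0 y0 r y : 0 < r -> r <= sq (y - y0) -> hat y0 r y = 0.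
Proof.
move=> r0 ry; rewrite /hat /pos_sq max_l ?expr0n //.
by rewrite subr_le0 mulrC ler_pdivlMr // mul1r.
Qed.

End Bump.

(** * Differentials of C^1 functions on the manifold *)

Section Covectors.
Context {R : realType} {n : nat} {M : topologicalType} (A : smooth_atlas R n M).
Local Notation V := 'rV[R]_n.
Implicit Types (i j : chart_index A) (x : M) (y : V) (phi psi : M -> R).

Lemma covecN i x (a : V) : \- covec i x a = covec i x (- a) :> cotangent A x.
Proof. by apply: cotangent_ext => v /=; rewrite !covecE -[- a]scaleN1r dotZl mulN1r. Qed.

Lemma C1_cst c : C1 A (fun=> c).
Proof. by move=> i; apply: C1_grad_Ck1 (@C1_grad_cst _ _ _ c); exact: chart_img_open. Qed.

Lemma C1D phi psi : C1 A phi -> C1 A psi -> C1 A (fun x => phi x + psi x).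
Proof.
move=> Cphi Cpsi i; apply: C1_grad_Ck1; first exact: chart_img_open.
exact: (C1_gradD (C1_C1_grad (i := i) Cphi) (C1_C1_grad (i := i) Cpsi)).
Qed.

Lemma C1Z c phi : C1 A phi -> C1 A (fun x => c * phi x).
Proof.
move=> Cphi i; apply: C1_grad_Ck1; first exact: chart_img_open.
exact: (C1_gradZ c (C1_C1_grad (i := i) Cphi)).
Qed.

Lemma C1N phi : C1 A phi -> C1 A (fun x => - phi x).
Proof.
by move=> /(C1Z (-1)); under eq_fun do rewrite mulN1r.
Qed.

Lemma C1B phi psi : C1 A phi -> C1 A psi -> C1 A (fun x => phi x - psi x).
Proof. by move=> Cphi /C1N; exact: C1D. Qed.

Lemma C1_continuous phi : C1 A phi -> continuous phi.
Proof.
move=> Cphi x; have xi := @chart_atP _ _ _ A x; set i := chart_at A x in xi.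
have [D _] := C1_C1_grad (i := i) Cphi (chart_imgP xi).
apply: (@cont_near_eq _ _ ((phi \o chart_inv i) \o chart i)).
  have : nbhs x (chart_dom i) by apply: open_nbhs_nbhs; split => //; exact: chart_dom_open.
  by apply: filterS => z zi /=; rewrite chartE.
apply: continuous_comp; first exact: chart_cont.
by apply: (@differentiable_continuous _ _ R^o); exact: ex_diff.
Qed.

Lemma dman_of_is_diff phi i x (a : V) : C1 A phi -> chart_dom i x ->
  is_diff (chart i x) (phi \o chart_inv i : V -> R^o) (dot a : V -> R^o) ->
  dman A phi x = covec i x a.
Proof. by move=> Cphi xi /is_diff_dot_grad <-; exact: dman_covec. Qed.

Lemma dmanN phi x : C1 A phi -> dman A (fun x => - phi x) x = \- dman A phi x :> cotangent A x.
Proof.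
move=> Cphi; have xi := @chart_atP _ _ _ A x; set i := chart_at A x in xi.
rewrite (dman_covec Cphi xi) covecN.
apply: (dman_of_is_diff _ xi); first exact: C1N.
have [D _] := C1_gradN (C1_C1_grad (i := i) Cphi) (chart_imgP xi); exact: D.
Qed.

Lemma dman_addc phi c x : C1 A phi -> dman A (fun x => phi x + c) x = dman A phi x.
Proof.
move=> Cphi; have xi := @chart_atP _ _ _ A x; set i := chart_at A x in xi.
rewrite (dman_covec Cphi xi).
apply: (dman_of_is_diff _ xi); first by apply: C1D; [exact: Cphi|exact: C1_cst].
have [] := C1_gradD (C1_C1_grad (i := i) Cphi) (@C1_grad_cst R n _ c) (chart_imgP xi).
by rewrite addr0.
Qed.

(** At a point of contact the difference of the two functions is minimal, so
    its gradient vanishes. *)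
Lemma dman_touch phi psi x : C1 A phi -> C1 A psi ->
  (\forall z \near x, phi z <= psi z) -> phi x = psi x -> dman A phi x = dman A psi x.
Proof.
move=> Cphi Cpsi pp px; have xi := @chart_atP _ _ _ A x; set i := chart_at A x in xi.
rewrite (dman_covec Cphi xi) (dman_covec Cpsi xi); congr (covec i x _).
have [D _] := C1_gradB (C1_C1_grad (i := i) Cpsi) (C1_C1_grad (i := i) Cphi) (chart_imgP xi).
apply/esym/eqP; rewrite -subr_eq0; apply/eqP; apply: (grad_at_min D).
have : \forall z \near chart i x, phi (chart_inv i z) <= psi (chart_inv i z).
  have := chart_inv_cont (chart_imgP xi); rewrite /prop_for /continuous_at chartE // => H.
  exact: (H _ pp).
by apply: filterS => z /=; rewrite chartE // px subrr subr_ge0.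
Qed.

Lemma dman_cst c x : dman A (fun=> c) x = covec (chart_at A x) x 0.
Proof.
have xi := @chart_atP _ _ _ A x.
apply: (dman_of_is_diff _ xi); first exact: C1_cst.
by have [] := @C1_grad_cst R n _ c _ (chart_imgP xi).
Qed.

End Covectors.

(** * Globalization of local test functions *)

Section Extension.
Context {R : realType} {n : nat} {M : topologicalType} (A : smooth_atlas R n M).
Hypothesis M_hausdorff : hausdorff_space M.
Local Notation V := 'rV[R]_n.
Implicit Types (i j : chart_index A) (x : M) (y : V) (phi psi : M -> R).

Definition extend0 i (h : V -> R) x : R := if `[<chart_dom i x>] then h (chart i x) else 0.

Lemma extend0_in i h x : chart_dom i x -> extend0 i h x = h (chart i x).
Proof. by move=> xi; rewrite /extend0; case: asboolP. Qed.

Lemma extend0_out i h x : ~ chart_dom i x -> extend0 i h x = 0.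
Proof. by move=> xi; rewrite /extend0; case: asboolP. Qed.

(** Near a point of the chart domain the extension is a C^1 function of the
    coordinates; the other points have a neighborhood that avoids the image
    of [K], which is compact, hence closed, so the extension is zero there. *)
Lemma extend0_C1 i h F (K : set V) : C1_grad (chart_img i) h F -> compact K ->
  K `<=` chart_img i -> (forall y, chart_img i y -> ~ K y -> h y = 0) -> C1 A (extend0 i h).
Proof.
move=> hF cK Ki h0 j; apply: C1_grad_Ck1; first exact: chart_img_open.
have cL : closed (chart_inv i @` K).
  apply: compact_closed => //; apply: continuous_compact => //.
  by apply: continuous_in_subspaceT => y; rewrite inE => /Ki; exact: chart_inv_cont.
apply: C1_grad_intro => y jy.
have [xi|xi] := pselect (chart_dom i (chart_inv j y)).
  exists (overlap j i), (h \o transition j i); eexists; split; first exact: open_overlap.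
  - by [].
  - exact: comp_transition_C1_grad hF.
  - by move=> z [jz zi]; rewrite /= extend0_in.
exists [set z | chart_img j z /\ (~` (chart_inv i @` K)) (chart_inv j z)], (fun=> 0), (fun=> 0).
split.
- by apply: open_chart_preimage; exact: closed_openC.
- split => // -[z Kz zy]; apply: xi; rewrite -zy.
  exact/chart_inv_dom/Ki.
- exact: C1_grad_cst.
- move=> z [jz Lz] /=; have [zi|zi] := pselect (chart_dom i (chart_inv j z)); last exact: extend0_out.
  rewrite extend0_in //; apply: h0; first exact: chart_imgP.
  by move=> Kz; apply: Lz; exists (chart i (chart_inv j z)); rewrite ?chartE.
Qed.

Lemma extend0_is_diff i h F x : C1_grad (chart_img i) h F -> chart_dom i x ->
  is_diff (chart i x) (extend0 i h \o chart_inv i : V -> R^o) (dot (F (chart i x)) : V -> R^o).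
Proof.
move=> hF xi; apply: is_diff_near (hF _ (chart_imgP xi)).1.
have : nbhs (chart i x) (chart_img i).
  by apply: open_nbhs_nbhs; split; [exact: chart_img_open|exact: chart_imgP].
apply: filterS => z zi /=; rewrite extend0_in ?chart_invK //; exact: chart_inv_dom.
Qed.

Lemma chart_ball i y : chart_img i y ->
  exists2 r, 0 < r & forall z, sq (z - y) <= r -> chart_img i z.
Proof.
by move=> iy; apply: sq_near; apply: open_nbhs_nbhs; split => //; exact: chart_img_open.
Qed.

Lemma exists_peak x0 : exists theta : M -> R, [/\ C1 A theta, theta x0 = 1,
  (forall x, theta x <= 1) & forall x, x <> x0 -> theta x < 1].
Proof.
have xi := @chart_atP _ _ _ A x0; set i := chart_at A x0 in xi.
have [r r0 rP] := chart_ball (chart_imgP xi).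
have lt1 x : x <> x0 -> extend0 i (hat (chart i x0) r) x < 1.
  move=> xx0; have [xi'|xi'] := pselect (chart_dom i x); last by rewrite extend0_out.
  rewrite extend0_in //; apply: hat_lt1 => //; apply: contra_notN xx0 => /eqP E.
  by rewrite -(chartE xi') E chartE.
exists (extend0 i (hat (chart i x0) r)); split => //.
- apply: (@extend0_C1 i _ (hat_grad (chart i x0) r) [set z | sq (z - chart i x0) <= r]).
  + exact: C1_grad_hat.
  + exact: compact_sqball.
  + by move=> z /rP.
  + by move=> z _ /negP; rewrite -ltNge => zr; rewrite hat_eq0 // ltW.
- by rewrite extend0_in // hat_center.
- move=> x; have [->|/lt1/ltW//] := pselect (x = x0).
  by rewrite extend0_in // hat_center.
Qed.

(** Test functions must be defined and lie above [u] on the whole manifold.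
    The interpolation between [phi] and a constant above [u], with the
    weight [hat] of small support, does so and keeps value and gradient at
    the contact, where the weight is 1 and has gradient 0. *)
Lemma globalize (u : M -> R) (B : R) i x0 (phi : V -> R) F :
  (forall x, u x <= B) -> chart_dom i x0 -> C1_grad (chart_img i) phi F ->
  (\forall y \near chart i x0, u (chart_inv i y) <= phi y) -> u x0 = phi (chart i x0) ->
  exists psi, [/\ C1 A psi, forall x, u x <= psi x, psi x0 = u x0 &
    dman A psi x0 = covec i x0 (F (chart i x0))].
Proof.
move=> uB xi phiF uphi ux0; set y0 := chart i x0.
have [r1 r10 r1P] := chart_ball (chart_imgP xi).
have [r2 r20 r2P] := sq_near uphi.
pose r := Num.min r1 r2.
have r0 : 0 < r by rewrite lt_min r10.
pose h y := hat y0 r y * (phi y - B).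
have hF : C1_grad (chart_img i) h (fun y => hat y0 r y *: (F y - 0) + (phi y - B) *: hat_grad y0 r y).
  by apply: C1_gradM; [exact: C1_grad_hat|apply: C1_gradB => //; exact: C1_grad_cst].
have Ch : C1 A (extend0 i h).
  apply: (extend0_C1 hF (@compact_sqball R n y0 r)) => [z /= zr|z zi /negP].
    by apply: r1P; rewrite (le_trans zr) // ge_min lexx.
  by rewrite -ltNge => zr; rewrite /h hat_eq0 ?mul0r // ltW.
exists (fun x => extend0 i h x + B); split.
- by apply: C1D; [exact: Ch|exact: C1_cst].
- move=> x; have [xi'|xi'] := pselect (chart_dom i x); last by rewrite extend0_out // add0r.
  rewrite extend0_in // /h; have b0 := @hat_ge0 R n y0 r (chart i x).
  have b1 := @hat_le1 R n y0 r (chart i x) r0.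
  have [xr|rx] := leP (sq (chart i x - y0)) r.
    have : u x <= phi (chart i x).
      by have := r2P (chart i x); rewrite chartE //; apply; rewrite (le_trans xr) // ge_min lexx orbT.
    by have := uB x; move: (hat _ _ _) (u x) (phi _) b0 b1 => *; nra.
  by rewrite hat_eq0 ?mul0r ?add0r // ltW.
- by rewrite extend0_in // /h hat_center mul1r subrK.
- rewrite (dman_addc _ _ Ch); apply: (dman_of_is_diff Ch xi).
  have := extend0_is_diff hF xi; rewrite hat_center hat_grad_center scaler0 addr0 subr0 scale1r.
  exact.
Qed.

End Extension.

(** * Viscosity subsolutions and their stability *)

Section Subsolutions.
Context {R : realType} {n : nat} {M : topologicalType} (A : smooth_atlas R n M).
Local Notation V := 'rV[R]_n.
Implicit Types (i j : chart_index A) (x : M) (y : V) (u v w f phi psi : M -> R).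
Implicit Types (H : hamiltonian A).

Definition subsol H f u : Prop := continuous u /\
  forall phi x0, C1 A phi -> (forall x, u x <= phi x) -> phi x0 = u x0 ->
    H x0 (dman A phi x0) <= f x0.

(** The Hamiltonian satisfied by [- v] when [v] is a supersolution of [H]. *)
Definition Hopp H : hamiltonian A := fun x p => - H x (\- p).

Lemma Hopp_continuous H : hamiltonian_continuous H -> hamiltonian_continuous (Hopp H).
Proof.
move=> Hc i z zi.
have E : (fun z : V * V => - H (chart_inv i z.1) (covec i (chart_inv i z.1) (- z.2))) =
  (fun z : V * V => Hopp H (covec i (chart_inv i z.1) z.2)).
  by apply/funext => t; rewrite /Hopp covecN.
rewrite -E {E}.
apply: (@continuousN R R^o).
apply: (@continuous_comp _ _ _ (fun t : V * V => (t.1, - t.2))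
   (fun z => H (chart_inv i z.1) (covec i (chart_inv i z.1) z.2))).
  apply: continuous_at_pair.
    by apply: (@continuous_at_fst V V V id); exact: cvg_id.
  by apply: (@continuous_at_snd V V V (fun a => - a)); exact: opp_continuous.
by apply: Hc; move: zi; rewrite !inE => -[].
Qed.

(** What lets strict inequalities for test functions propagate to a
    neighborhood. *)
Lemma continuous_dman H phi : hamiltonian_continuous H -> C1 A phi ->
  continuous (fun x => H x (dman A phi x)).
Proof.
move=> Hc Cphi x; have xi := @chart_atP _ _ _ A x; set i := chart_at A x in xi.
pose G := grad (phi \o chart_inv i).
apply: (@cont_near_eq _ _ ((fun z => H (chart_inv i z.1) (covec i (chart_inv i z.1) z.2))
   \o ((fun y => (y, G y)) \o chart i))).
  have : nbhs x (chart_dom i) by apply: open_nbhs_nbhs; split => //; exact: chart_dom_open.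
  by apply: filterS => z zi; rewrite /= (dman_covec Cphi zi) chartE.
apply: continuous_comp; last first.
  by apply: Hc; rewrite inE; split => //; exact: chart_imgP.
apply: continuous_comp; first exact: chart_cont.
have [_ CG] := C1_C1_grad (i := i) Cphi (chart_imgP xi).
by apply: (@continuous_at_pair V V V id G); [exact: cvg_id|exact: CG].
Qed.

Hypothesis M_compact : compact [set: M].

Lemma attains_max (x0 : M) (f : M -> R) : continuous f ->
  exists x, forall z, f z <= f x.
Proof.
move=> cf; have ne : [set: M] !=set0 by exists x0.
have [x _ xm] := compact_EVT_max ne M_compact (continuous_subspaceT cf).
by exists x => z; apply: xm; rewrite inE.
Qed.

Lemma attains_min (x0 : M) (f : M -> R) : continuous f ->
  exists x, forall z, f x <= f z.
Proof.
move=> cf; have [x xm] : exists x, forall z, - f z <= - f x.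
  by apply: attains_max => // z; apply: (@continuousN R R^o); exact: cf.
by exists x => z; rewrite -lerN2.
Qed.

(** Off a neighborhood of its strict maximum point, a function on a compact
    space stays away from its maximum. *)
Lemma strict_off (theta : M -> R) x0 (N : set M) : continuous theta ->
  (forall x, x <> x0 -> theta x < 1) -> nbhs x0 N ->
  exists2 d, 0 < d & forall x, 1 - theta x < d -> N x.
Proof.
move=> ct t1 xN.
have cK : compact (~` interior N).
  apply: subclosed_compact M_compact _ => //.
  exact: open_closedC (@open_interior _ N).
have [K0|K0] := pselect ((~` interior N) = set0).
  exists 1 => // x _; apply: contrapT => xnN.
  suff : (set0 : set M) x by [].
  by rewrite -K0 => /interior_subset.
have ne : (~` interior N) !=set0 by apply/set0P/eqP.
have [p pK pm] := compact_EVT_max ne cK (continuous_subspaceT ct).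
exists (1 - theta p).
  rewrite subr_gt0; apply: t1 => px; move: pK; rewrite inE px; apply.
  exact: xN.
move=> x; rewrite ltrD2l ltrN2 => xp; apply: contrapT => xnN.
have : x \in ~` interior N by rewrite inE => /interior_subset.
by move=> /pm; rewrite leNgt xp.
Qed.

Hypothesis M_hausdorff : hausdorff_space M.

(** A test function can be made strict without changing its value and
    differential at the contact point: add [1 - theta] where [theta] has a
    strict maximum there. *)
Lemma strict_test x0 phi : C1 A phi -> exists phi1, [/\ C1 A phi1,
  (forall x, phi x <= phi1 x), phi1 x0 = phi x0, dman A phi1 x0 = dman A phi x0 &
  forall N, nbhs x0 N -> exists2 d, 0 < d & forall x, phi1 x - phi x < d -> N x].
Proof.
move=> Cphi; have [theta [Ct t0 t1 t2]] := exists_peak A M_hausdorff x0.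
have C2 : C1 A (fun x => phi x + (1 - theta x)).
  by apply: C1D; [exact: Cphi|apply: C1B; [exact: C1_cst|exact: Ct]].
have le2 x : phi x <= phi x + (1 - theta x) by rewrite lerDl subr_ge0.
exists (fun x => phi x + (1 - theta x)); split.
- exact: C2.
- exact: le2.
- by rewrite t0 subrr addr0.
- apply/esym/(dman_touch Cphi C2); last by rewrite t0 subrr addr0.
  by near=> x; exact: le2.
- move=> N xN; have [d d0 dN] := strict_off (C1_continuous Ct) t2 xN.
  by exists d => // x; rewrite addrAC subrr add0r; exact: dN.
Unshelve. all: by end_near. Qed.

(** Uniform limits and suprema at once: [u] need only be approached from
    below at the contact point by functions that nowhere exceed it by much.
    For a strict test function touching [u] at [x0], the maximum point of [w
    - phi] is close to [x0] and [w] is close to [u] there, so the inequality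
    of [w] passes to the limit. *)
Lemma subsol_stable H (kappa : R -> R) u : hamiltonian_continuous H -> continuous kappa ->
  continuous u ->
  (forall x0 e, 0 < e -> exists w h, [/\ subsol H h w, forall x, w x <= u x + e,
      u x0 - e <= w x0 & forall x, h x <= kappa (w x) + e]) ->
  subsol H (kappa \o u) u.
Proof.
move=> Hc kc uc W; split => // phi x0 Cphi uphi phi0 /=.
rewrite leNgt; apply/negP => lt0.
have [phi1 [C1phi le1 eq1 d1 st]] := strict_test x0 Cphi.
set a := kappa (u x0) in lt0; set b := H x0 _ in lt0.
pose eta := (b - a) / 3; have eta0 : 0 < eta by rewrite /eta; lra.
have N1 : \forall x \near x0, b - eta < H x (dman A phi1 x).
  apply: near_gt; first exact: continuous_dman.
  by rewrite d1 -/b; lra.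
have [rho rho0 N2] : exists2 rho, 0 < rho & forall s, `|u x0 - s| < rho -> kappa s < a + eta.
  have : \forall s \near u x0, kappa s < a + eta.
    by apply: near_lt; [exact: kc|rewrite -/a; lra].
  by move=> /nbhs_ballP[rho rho0 N2]; exists rho.
have N3 : \forall x \near x0, `|u x0 - u x| < rho / 2.
  by have /cvgrPdist_lt := uc x0; apply; rewrite divr_gt0.
have [d d0 dN] := st _ (filterI N1 N3).
pose e := Num.min (rho / 2) (Num.min eta (d / 3)).
have e0 : 0 < e by rewrite !lt_min eta0 !divr_gt0.
have e1 : e <= rho / 2 by rewrite ge_min lexx.
have e2 : e <= eta by rewrite !ge_min lexx orbT.
have e3 : e <= d / 3 by rewrite !ge_min lexx !orbT.
have [w [h [[wc wsub] wu w0 hk]]] := W x0 e e0.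
have [x xmax] : exists x, forall z, w z - phi1 z <= w x - phi1 x.
  apply: (attains_max x0) => z; apply: continuousB; first exact: wc.
  exact: C1_continuous.
have m0 := xmax x0.
have px : phi1 x - phi x < d.
  by have := uphi x; have := wu x; move: m0; rewrite eq1 phi0; lra.
have [/= X1 X3] := dN _ px.
have Hx : H x (dman A phi1 x) <= h x.
  rewrite -(dman_addc (w x - phi1 x) x C1phi); apply: wsub.
  - by apply: C1D; [exact: C1phi|exact: C1_cst].
  - by move=> z; have := xmax z; lra.
  - by rewrite addrC subrK.
have K : kappa (w x) < a + eta.
  apply: N2; have := wu x; have := uphi x; have := le1 x.
  move: m0; rewrite eq1 phi0; move: X3; rewrite !ltr_norml => /andP[? ?] *.
  by apply/andP; split; lra.
by have := hk x; rewrite /eta in e2 K X1; lra.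
Qed.

End Subsolutions.

Lemma quad_delta (R : realType) n (c : R) (G : 'M[R]_n) (k : 'I_n) :
  ((c *: delta_mx 0 k : 'rV[R]_n) *m G *m (c *: (delta_mx 0 k : 'rV[R]_n))^T) 0 0 =
  c ^+ 2 * G k k.
Proof.
have rE (H : 'M[R]_(n, 1)) : ((c *: delta_mx 0 k : 'rV[R]_n) *m H) 0 0 = c * H k 0.
  rewrite mxE (bigD1 k) //= big1 ?addr0; first by rewrite !mxE !eqxx mulr1.
  by move=> j jk; rewrite !mxE eqxx (negbTE jk) mulr0 mul0r.
rewrite -mulmxA rE mxE (bigD1 k) //= big1 ?addr0.
  by rewrite !mxE !eqxx mulr1; ring.
by move=> j jk; rewrite !mxE eqxx (negbTE jk) !mulr0.
Qed.

(** * Coercivity in coordinates *)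

Section Coercivity.
Context {R : realType} {n : nat} {M : topologicalType} (A : smooth_atlas R n M).
Local Notation V := 'rV[R]_n.
Implicit Types (i j k : chart_index A) (x : M) (y : V).

Lemma transition_cocycle i j k y v (d : V) : overlap i j y -> overlap i k y ->
  d = 'd (transition i j) y v ->
  'd (transition i k) y v = 'd (transition j k) (transition i j y) d.
Proof.
move=> ijy iky dE; have E2 := etrans dE (diff_transitionE v ijy).
have jky : overlap j k (transition i j y).
  by split; [exact: transition_img|rewrite transition_inv //; case: iky].
apply: (etrans (diff_transitionE v iky)); apply/esym.
apply: (etrans (diff_transitionE d jky)); apply/esym.
apply/rowP => l; rewrite !mxE.
have [Dh _] := @transition_C1_grad R n M A j k l _ jky.
have Dt := comp_transition_diff ijy Dh.
have E : \forall z \near y, ((fun w => transition j k w 0 l) \o transition i j) z = transition i k z 0 l.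
  by apply: filterS (nbhs_overlap ijy) => z zij; rewrite /= /transition /= transition_inv.
have -> := is_diff_dot_grad (is_diff_near E Dt).
by rewrite dot_suml E2; apply: eq_bigr => m _; rewrite mxE dotZl.
Qed.

Lemma transition_id i y v : chart_img i y -> 'd (transition i i) y v = v.
Proof.
move=> iy; have Oy : overlap i i y by split => //; exact: chart_inv_dom.
rewrite diff_transitionE //; apply/rowP => l; rewrite mxE.
have [D _] := @C1_grad_coord R n setT l y I.
have E : \forall z \near y, (fun w : V => w 0 l) z = transition i i z 0 l.
  by apply: filterS (nbhs_overlap Oy) => z [zi _]; rewrite /transition /= chart_invK.
by rewrite (is_diff_dot_grad (is_diff_near E D)) dotC dot_delta.
Qed.

(** The chart coordinates of a tangent vector are arbitrary: its coordinates
    in the other charts are then prescribed by the differentials of the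
    transition maps, which are compatible by the chain rule. *)
Lemma tangent_of_coord i x (xi : V) : chart_dom i x -> exists v : tangent A x, v i = xi.
Proof.
move=> ix.
pose t (j : chart_index A) : V :=
  if `[<chart_dom j x>] then 'd (transition i j) (chart i x) xi else 0.
have tP : t \in @is_tangent _ _ _ A x.
  apply/asboolP; split => [j k jx kx|j jx]; rewrite /t; last by case: asboolP.
  case: asboolP => // _; case: asboolP => // _.
  have := transition_cocycle (overlap_chart ix jx) (overlap_chart ix kx) (erefl ('d (transition i j) (chart i x) xi)).
  by rewrite transitionE.
exists (Tangent tP) => /=; rewrite /t; case: asboolP => // _.
by apply: transition_id; exact: chart_imgP.
Qed.

Variable rho : riemannian_metric A.

Lemma rdot0l x (w : tangent A x) : rdot rho 0 w = 0.
Proof.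
have := rdotP rho 1 (0 : tangent A x) 0 w; rewrite scale1r addr0 mul1r => H.
by apply: (addrI (rdot rho 0 w)); rewrite addr0 -H.
Qed.

Lemma rdot_ge0 x (v : tangent A x) : 0 <= rdot rho v v.
Proof.
by have [->|v0] := eqVneq v 0; [rewrite rdot0l|exact/ltW/rdot_gt0].
Qed.

(** From the positivity of the form at [w + v] and [w - v]. *)
Lemma rdot_young x (w v : tangent A x) : `|rdot rho w v| <= (rdot rho w w + rdot rho v v) / 2.
Proof.
have E c : rdot rho (c *: v + w) (c *: v + w) =
    c ^+ 2 * rdot rho v v + 2 * c * rdot rho w v + rdot rho w w.
  rewrite rdotP [rdot rho v _]rdotC [rdot rho w _]rdotC !rdotP.
  by rewrite [rdot rho v w]rdotC; ring.
have := rdot_ge0 (1 *: v + w); have := rdot_ge0 (- 1 *: v + w); rewrite !E => h1 h2.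
by rewrite ler_norml; apply/andP; split; lra.
Qed.

(** The supremum that defines the dual norm is finite: the matrix of the
    metric is invertible, so the covector is represented by a tangent
    vector, and [rdot_young] applies. *)
Lemma conorm_ubound i x (a : V) : chart_dom i x ->
  has_ubound [set `|covec i x a v| | v in [set v | tnorm rho v <= 1]].
Proof.
move=> ix; have [G [_ GP]] := rdot_smooth rho i.
(* a vector in the kernel of the matrix has norm 0 *)
have Gu : G (chart i x) \in unitmx.
  rewrite -row_free_unit -kermx_eq0; apply/eqP/row_matrixP => l; rewrite row0.
  have [w wi] := tangent_of_coord (row l (kermx (G (chart i x)))) ix.
  suff w0 : w = 0 by rewrite -wi w0.
  apply/eqP; apply: contraT => /(rdot_gt0 rho).
  by rewrite (GP _ _ _ ix) wi -row_mul mulmx_ker row0 mul0mx mxE ltxx.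
have [w wi] := tangent_of_coord (a *m invmx (G (chart i x))) ix.
exists ((rdot rho w w + 1) / 2) => _ [v /= v1 <-].
have -> : covec i x a v = rdot rho w v.
  rewrite (GP _ _ _ ix) wi mulmxKV // covecE mxE.
  by apply: eq_bigr => k _; rewrite mxE.
apply: le_trans (rdot_young _ _) _.
have : rdot rho v v <= 1.
  by rewrite -[leLHS]sqr_sqrtr ?rdot_ge0 // expr_le1 // sqrtr_ge0.
by lra.
Qed.

(** Near [y0] the diagonal coefficients of the metric are bounded by [B^2],
    so the coordinate vectors divided by [B] have norm at most 1 and the
    dual norm of the covector of coordinates [a] is at least [|a| / B]. *)
Lemma coercive_local (H : hamiltonian A) i (y0 : V) (K : R) :
  hamiltonian_coercive rho H -> chart_img i y0 ->
  exists2 C, 0 < C & \forall y \near y0, forall a,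
    H (chart_inv i y) (covec i (chart_inv i y) a) <= K -> `|a| <= C.
Proof.
move=> /(_ (K + 1))[r Hr] iy0; have [G [Gs GP]] := rdot_smooth rho i.
have [B B0 HB] : exists2 B : R, 0 < B & \forall y \near y0, forall k : 'I_n, G y k k <= B ^+ 2.
  pose B := 1 + \sum_(k < n) `|G y0 k k|.
  have s0 : 0 <= \sum_(k < n) `|G y0 k k| by apply: sumr_ge0.
  exists B; first by rewrite ltr_pwDl.
  apply: (@filter_forall _ _ (fun (k : 'I_n) y => G y k k <= B ^+ 2) (nbhs y0)) => k.
  have : \forall y \near y0, G y k k < B ^+ 2.
    apply: near_lt.
      by apply: (Gs k k 0%N); rewrite inE.
    have : `|G y0 k k| <= \sum_(k < n) `|G y0 k k|.
      by rewrite (bigD1 k) //= lerDl; apply: sumr_ge0.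
    have := ler_norm (G y0 k k); rewrite /B; move: (\sum_k _) s0 => s *; nra.
  by apply: filterS => y /ltW.
exists (Num.max 1 (r * B)); first by rewrite lt_max ltr01.
have : \forall y \near y0, chart_img i y.
  by apply: open_nbhs_nbhs; split => //; exact: chart_img_open.
apply: filterS2 HB => y GB iy a HK.
have ix := chart_inv_dom iy; set x := chart_inv i y in ix HK *.
apply: norm_le_coord => [|k]; first by rewrite le_max ler01.
rewrite le_max; apply/orP; right; rewrite leNgt; apply/negP => ak.
suff : r <= conorm rho (covec i x a) by move=> /Hr; rewrite leNgt; move=> /negP; apply; lra.
have [v vi] := tangent_of_coord (B^-1 *: delta_mx 0 k) ix.
apply: (@le_trans _ _ `|covec i x a v|).
  rewrite covecE vi linearZ /= dot_delta [_ *: _]/(_ * _) normrM gtr0_norm ?invr_gt0 //.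
  by rewrite mulrC ler_pdivlMr // ltW.
apply: ub_le_sup; first exact: conorm_ubound.
exists v => //=; rewrite /tnorm -[leRHS]sqrtr1 ler_wsqrtr //.
rewrite (GP _ _ _ ix) vi chart_invK //.
have -> : ((B^-1 *: delta_mx 0 k : V) *m G y *m (B^-1 *: (delta_mx 0 k : V))^T) 0 0 = B ^- 2 * G y k k.
  by apply: (etrans (quad_delta _ _ _)); rewrite exprVn.
by rewrite mulrC ler_pdivrMr ?exprn_gt0 // mul1r; exact: GB.
Qed.

End Coercivity.

(** * The sum rule for subsolutions *)

Section SumRule.
Context {R : realType} {n : nat} {M : topologicalType} (A : smooth_atlas R n M).
Local Notation V := 'rV[R]_n.
Implicit Types (i j : chart_index A) (x : M) (y : V) (u v f h : M -> R).
Implicit Types (H : hamiltonian A).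
Hypothesis M_compact : compact [set: M].
Hypothesis M_hausdorff : hausdorff_space M.

(** A contact of [s u] in a chart, up to an additive constant, gives a test
    covector of [u]. *)
Lemma touch_local H f u i y s (phi : V -> R) F : subsol H f u -> chart_img i y -> 0 < s ->
  C1_grad (chart_img i) phi F ->
  (\forall z \near y, s * u (chart_inv i z) - phi z <= s * u (chart_inv i y) - phi y) ->
  H (chart_inv i y) (covec i (chart_inv i y) (s^-1 *: F y)) <= f (chart_inv i y).
Proof.
move=> [uc usub] iy s0 phiF tch; set x := chart_inv i y.
have ix : chart_dom i x by exact: chart_inv_dom.
have Ey : chart i x = y by exact: chart_invK.
pose c := u x - s^-1 * phi y.
have phiF1 : C1_grad (chart_img i) (fun z => s^-1 * phi z + c) (fun z => s^-1 *: F z).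
  apply: C1_grad_eq (C1_gradD (C1_gradZ s^-1 phiF) (@C1_grad_cst R n _ c)) _ _ => // z _.
  by near=> w; rewrite addr0.
have [xm um] := attains_max M_compact x uc.
have [| |psi [Cpsi upsi psix dpsi]] := globalize M_hausdorff um ix phiF1.
- rewrite Ey; apply: filterS tch => z Hz; rewrite /c.
  have : s^-1 * (s * u (chart_inv i z) - phi z) <= s^-1 * (s * u x - phi y).
    by rewrite ler_pM2l ?invr_gt0.
  by rewrite !mulrBr !mulKf ?gt_eqF //; lra.
- by rewrite Ey /c addrC subrK.
by have := usub psi x Cpsi upsi psix; rewrite dpsi Ey.
Unshelve. all: by end_near. Qed.

(** Each of the two contacts provided by [doubling] gives a local test
    function; the covectors obtained satisfy the sum rule up to the
    variation of the gradient of [phi]. *)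
Lemma sum_rule_approx H H2 f h u v s t (phi : M -> R) i y0 :
  subsol H f u -> subsol H2 h v -> 0 < s -> 0 < t -> C1 A phi -> chart_img i y0 ->
  (forall x, s * u x + t * v x <= phi x) ->
  s * u (chart_inv i y0) + t * v (chart_inv i y0) = phi (chart_inv i y0) ->
  forall e, 0 < e -> exists z : (V * V) * V,
   let: ((x, y), p) := z in
   let q := t^-1 *: (grad (phi \o chart_inv i) x + 2 *: (x - y0) - s *: p) in
   [/\ `|x - y0| < e, `|y - y0| < e, chart_img i x /\ chart_img i y,
    H (chart_inv i x) (covec i (chart_inv i x) p) <= f (chart_inv i x) &
    H2 (chart_inv i y) (covec i (chart_inv i y) q) <= h (chart_inv i y)].
Proof.
move=> usub vsub s0 t0 Cphi iy0 uvphi eq0.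
have [r r0 rP] : exists2 r, 0 < r & forall z, `|z - y0| <= r -> chart_img i z.
  have : \forall z \near y0, chart_img i z.
    by apply: open_nbhs_nbhs; split => //; exact: chart_img_open.
  move=> /near_coord[d d0 dP]; exists (d / 2); first by rewrite divr_gt0.
  by move=> z zd; apply: dP; apply: le_lt_trans zd _; lra.
have cont (w : M -> R) c y : continuous w -> chart_img i y ->
    {for y, continuous (fun z => c * w (chart_inv i z))}.
  move=> cw iy; apply: continuousM; first exact: cst_continuous.
  by apply: continuous_comp; [exact: chart_inv_cont|exact: cw].
move=> e e0.
have er0 : 0 < Num.min e r by rewrite lt_min e0.
have Hc y : `|y - y0| <= r -> [/\ {for y, continuous (fun z => s * u (chart_inv i z))},
    {for y, continuous (fun z => t * v (chart_inv i z))} & {for y, continuous (phi \o chart_inv i)}].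
  move=> /rP iy; split; [by apply: cont => //; case: usub|by apply: cont => //; case: vsub|].
  have [D _] := C1_C1_grad (i := i) Cphi iy.
  by apply: (@differentiable_continuous _ _ R^o); exact: ex_diff.
have Hle y : `|y - y0| <= r -> s * u (chart_inv i y) + t * v (chart_inv i y) <= (phi \o chart_inv i) y.
  by move=> _; exact: uvphi.
have [x [y [K [xe ye Hx Hy]]]] := doubling r0 Hc Hle eq0 er0.
move: xe ye; rewrite !lt_min => /andP[xe xr] /andP[ye yr].
have ix : chart_img i x by apply: rP; exact: ltW.
have iy : chart_img i y by apply: rP; exact: ltW.
have inr z : `|z - y0| < r -> \forall w \near z, `|w - y0| <= r.
  move=> zr; apply: (@filterS _ (nbhs z) _ (fun w => `|w - y0| < r)) => [w|]; first exact: ltW.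
  apply: (@near_lt R V (fun w => `|w - y0|) z r _ zr).
  apply: (@continuous_comp _ _ _ (fun w : V => w - y0) (fun w => `|w|)).
    by apply: continuousB; [exact: cvg_id|exact: cst_continuous].
  exact: norm_continuous.
pose g1 z := grad (phi \o chart_inv i) z + 2 *: (z - y0).
have sqY c : C1_grad (chart_img i) (fun z => K * sq (z - c)) (fun z => K *: (2 *: (z - c))).
  by apply: C1_gradZ; exact: C1_grad_sqB.
have Cx : C1_grad (chart_img i) (fun z => (phi (chart_inv i z) + sq (z - y0)) + K * sq (z - y))
   (fun z => g1 z + K *: (2 *: (z - y))).
  by apply: C1_gradD; [apply: C1_gradD; [exact: C1_C1_grad|exact: C1_grad_sqB]|exact: sqY].
exists ((x, y), s^-1 *: (g1 x + K *: (2 *: (x - y)))); split => //.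
- apply: (touch_local usub ix s0 Cx).
  by apply: filterS (inr x xr) => z /Hx /=; lra.
- have -> : t^-1 *: (grad (phi \o chart_inv i) x + 2 *: (x - y0) -
      s *: (s^-1 *: (g1 x + K *: (2 *: (x - y))))) = t^-1 *: (K *: (2 *: (y - x))).
    congr (_ *: _); rewrite scalerA divff ?gt_eqF // scale1r opprD addrA subrr add0r.
    by rewrite -!scalerN opprB.
  apply: (touch_local vsub iy t0 (sqY x)).
  by apply: filterS (inr y yr) => z /Hy.
Qed.

Variable rho : riemannian_metric A.

(** Limit of [sum_rule_approx]. Coercivity keeps the covectors [p] bounded,
    and then also the covectors [q], so both have limits. *)
Lemma sum_rule H H2 f h u v s t (phi : M -> R) x0 :
  hamiltonian_continuous H -> hamiltonian_continuous H2 -> hamiltonian_coercive rho H ->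
  continuous f -> continuous h ->
  subsol H f u -> subsol H2 h v -> 0 < s -> 0 < t -> C1 A phi ->
  (forall x, s * u x + t * v x <= phi x) -> s * u x0 + t * v x0 = phi x0 ->
  exists p q : cotangent A x0, [/\ s \*: p \+ t \*: q = dman A phi x0 :> cotangent A x0,
    H x0 p <= f x0 & H2 x0 q <= h x0].
Proof.
move=> Hc H2c Hco fc hc usub vsub s0 t0 Cphi uvphi eq0.
have ix := @chart_atP _ _ _ A x0; set i := chart_at A x0 in ix.
pose y0 := chart i x0; have iy : chart_img i y0 by exact: chart_imgP.
have Ex : chart_inv i y0 = x0 by exact: chartE.
have cf (w : M -> R) : continuous w -> {for y0, continuous (w \o chart_inv i)}.
  by move=> cw; apply: continuous_comp; [exact: chart_inv_cont|exact: cw].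
pose K := f x0 + 1.
have [C C0 HC] := coercive_local K Hco iy.
have HfK : \forall y \near y0, f (chart_inv i y) < K.
  by apply: (near_lt (cf f fc)); rewrite /= Ex /K ltrDl.
have [d d0 Hd] : exists2 d, 0 < d & forall y, `|y - y0| < d ->
    f (chart_inv i y) < K /\ forall a, H (chart_inv i y) (covec i (chart_inv i y) a) <= K -> `|a| <= C.
  by apply/near_coord; apply: filterS2 HfK HC => y.
pose g1 z := grad (phi \o chart_inv i) z + 2 *: (z - y0).
have cg1 : {for y0, continuous g1}.
  have [_ Cg] := C1_C1_grad (i := i) Cphi iy.
  apply: continuousD; first exact: Cg.
  apply: continuousZ; first exact: cst_continuous.
  by apply: continuousB; [exact: cvg_id|exact: cst_continuous].
pose Pr e (z : (V * V) * V) := let: ((x, y), p) := z in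
   let q := t^-1 *: (g1 x - s *: p) in
   [/\ `|x - y0| < e, `|y - y0| < e, `|p| <= C,
    H (chart_inv i x) (covec i (chart_inv i x) p) <= f (chart_inv i x) &
    H2 (chart_inv i y) (covec i (chart_inv i y) q) <= h (chart_inv i y)].
have EX e : exists z, 0 < e -> Pr e z.
  have [e0|e0] := ltP 0 e; last by exists ((0, 0), 0).
  have ed0 : 0 < Num.min e d by rewrite lt_min e0.
  have eq0' : s * u (chart_inv i y0) + t * v (chart_inv i y0) = phi (chart_inv i y0) by rewrite Ex.
  have [[[x y] p] /= [xe ye _ Hx Hy]] := sum_rule_approx usub vsub s0 t0 Cphi iy uvphi eq0' ed0.
  exists ((x, y), p) => _; split => //.
  - by move: xe; rewrite lt_min => /andP[].
  - by move: ye; rewrite lt_min => /andP[].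
  - have xd : `|x - y0| < d by move: xe; rewrite lt_min => /andP[].
    by have [fK HK] := Hd x xd; apply: HK; exact: le_trans Hx (ltW fK).
have [z zP] := choice EX.
pose F : set_system R := 0^'+.
have FF : ProperFilter F by exact: at_right_proper_filter.
have Fe b : 0 < b -> F [set e | 0 < e < b] by exact: at_right0_itv.
have cB : compact [set p : V | `|p| <= C].
  rewrite (_ : [set p : V | _] = [set p | `|p - 0| <= C]); first exact: compact_cball.
  by apply/seteqP; split => p /=; rewrite subr0.
have [|P [PB cl]] := cB ((fun e => (z e).2) @ F) _.
  apply: (filterS _ (Fe 1 ltr01)) => e /andP[/zP + _] /=.
  by case: (z e) => -[x y] p [].
have key (T : set (V * V * V)) : nbhs ((y0, y0), P) T -> exists e, 0 < e /\ T (z e).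
  move=> [[TT T3] [[[T1 T2] [/near_coord[d1 d10 n1] /near_coord[d2 d20 n2] sub12]] n3] sub].
  have d12 : 0 < Num.min d1 d2 by rewrite lt_min d10.
  have [e /andP[e0]] := cluster_near _ cl n3 (Fe _ d12).
  rewrite lt_min => /andP[e1 e2] e3; exists e; split => //.
  have := zP e e0; move: e3; case: (z e) => -[x y] p /= e3 [xe ye _ _ _].
  apply: sub; split => //=; apply: sub12; split => /=.
    by apply: n1; exact: lt_trans e1.
  by apply: n2; exact: lt_trans e2.
pose Q := t^-1 *: (g1 y0 - s *: P).
exists (covec i x0 P), (covec i x0 Q); split.
- apply: cotangent_ext => w; rewrite (dman_covec Cphi ix).
  rewrite -[LHS]/(s * dot P (w i) + t * dot Q (w i)) -[RHS]/(dot _ (w i)).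
  rewrite -!dotZl -dotDl; congr (dot _ _).
  by rewrite /Q scalerA divff ?gt_eqF // scale1r addrC subrK /g1 subrr scaler0 addr0.
- rewrite leNgt; apply/negP => lt0.
  pose c := (f x0 + H x0 (covec i x0 P)) / 2.
  have N1 : \forall w \near ((y0, y0), P), c < H (chart_inv i w.1.1) (covec i (chart_inv i w.1.1) w.2).
    apply: (@near_gt _ _ (fun w : V * V * V => H (chart_inv i w.1.1) (covec i (chart_inv i w.1.1) w.2))); last by rewrite /= Ex /c; lra.
    apply: (@continuous_comp _ _ _ (fun w : V * V * V => (w.1.1, w.2))
      (fun w : V * V => H (chart_inv i w.1) (covec i (chart_inv i w.1) w.2))).
      apply: continuous_at_pair; last by apply: (@continuous_at_snd (V * V)%type V V id); exact: cvg_id.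
      apply: (@continuous_at_fst (V * V)%type V V (fun w => w.1)).
      by apply: (@continuous_at_fst V V V id); exact: cvg_id.
    by apply: Hc; rewrite inE.
  have N2 : \forall w \near ((y0, y0), P), f (chart_inv i w.1.1) < c.
    apply: (@near_lt _ _ (fun w : V * V * V => f (chart_inv i w.1.1))); last by rewrite /= Ex /c; lra.
    apply: (@continuous_at_fst (V * V)%type V R (fun w => f (chart_inv i w.1))).
    by apply: (@continuous_at_fst V V R (f \o chart_inv i)); exact: cf.
  have [e [e0 [/= e1 e2]]] := key _ (filterI N1 N2).
  have := zP e e0; move: e1 e2; case: (z e) => -[x y] p /= e1 e2 [_ _ _ Hx _].
  by have := lt_trans (lt_le_trans e1 Hx) e2; rewrite ltxx.
- rewrite leNgt; apply/negP => lt0.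
  pose c := (h x0 + H2 x0 (covec i x0 Q)) / 2.
  have N1 : \forall w \near ((y0, y0), P),
     c < H2 (chart_inv i w.1.2) (covec i (chart_inv i w.1.2) (t^-1 *: (g1 w.1.1 - s *: w.2))).
    apply: (@near_gt _ _ (fun w : V * V * V => H2 (chart_inv i w.1.2) (covec i (chart_inv i w.1.2) (t^-1 *: (g1 w.1.1 - s *: w.2))))); last by rewrite /= Ex -/Q /c; lra.
    apply: (@continuous_comp _ _ _ (fun w : V * V * V => (w.1.2, t^-1 *: (g1 w.1.1 - s *: w.2)))
      (fun w : V * V => H2 (chart_inv i w.1) (covec i (chart_inv i w.1) w.2))).
      apply: continuous_at_pair.
        apply: (@continuous_at_fst (V * V)%type V V (fun w => w.2)).
        by apply: (@continuous_at_snd V V V id); exact: cvg_id.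
      apply: continuousZ; first exact: cst_continuous.
      apply: continuousB.
        apply: (@continuous_at_fst (V * V)%type V V (fun w => g1 w.1)).
        by apply: (@continuous_at_fst V V V g1).
      apply: continuousZ; first exact: cst_continuous.
      by apply: (@continuous_at_snd (V * V)%type V V id); exact: cvg_id.
    by apply: H2c; rewrite inE.
  have N2 : \forall w \near ((y0, y0), P), h (chart_inv i w.1.2) < c.
    apply: (@near_lt _ _ (fun w : V * V * V => h (chart_inv i w.1.2))); last by rewrite /= Ex /c; lra.
    apply: (@continuous_at_fst (V * V)%type V R (fun w => h (chart_inv i w.2))).
    by apply: (@continuous_at_snd V V R (h \o chart_inv i)); exact: cf.
  have [e [e0 [/= e1 e2]]] := key _ (filterI N1 N2).
  have := zP e e0; move: e1 e2; case: (z e) => -[x y] p /= e1 e2 [_ _ _ _ Hx].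
  by have := lt_trans (lt_le_trans e1 Hx) e2; rewrite ltxx.
Qed.

End SumRule.

(** * Equicontinuous families *)

Section Equicontinuity.
Context {R : realType} {M : topologicalType}.
Hypothesis M_compact : compact [set: M].

Definition equicont (P : set (M -> R)) :=
  forall x0 e, 0 < e -> \forall x \near x0, forall w, P w -> `|w x - w x0| <= e.

(** The points whose distance in value to a base point is bounded uniformly
    over the family form an open and closed set, hence everything by
    connectedness; compactness makes the bound uniform. *)
Lemma equicont_osc (P : set (M -> R)) : connected [set: M] -> equicont P ->
  exists C, forall w x y, P w -> w x - w y <= C.
Proof.
move=> conn eqP.
have [[x0 _]|nM] := pselect ([set: M] !=set0); last first.
  by exists 0 => w x; exfalso; apply: nM; exists x.
pose D : set M := [set x | exists C, forall w, P w -> `|w x - w x0| <= C].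
have near1 x : \forall y \near x, forall w, P w -> `|w y - w x| <= 1 by exact: eqP.
have oD : open D.
  rewrite openE => x [C HC]; rewrite /interior.
  apply: filterS (near1 x) => y Hy; exists (C + 1) => w Pw.
  have -> : w y - w x0 = (w x - w x0) + (w y - w x) by ring.
  by apply: le_trans (ler_normD _ _) _; apply: lerD; [exact: HC|exact: Hy].
have cD : closed D.
  rewrite -(setCK D); apply: open_closedC; rewrite openE => x nDx; rewrite /interior.
  apply: filterS (near1 x) => y Hy [C HC]; apply: nDx; exists (C + 1) => w Pw.
  have -> : w x - w x0 = (w y - w x0) - (w y - w x) by ring.
  by apply: le_trans (ler_normB _ _) _; apply: lerD; [exact: HC|exact: Hy].
have DT : D = setT.
  apply: conn.
  - by exists x0; exists 0 => w _; rewrite subrr normr0.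
  - by exists D; rewrite ?setTI.
  - by exists D; rewrite ?setTI.
have /compact_near_coveringP/(_ R (pinfty_nbhs R)
  (fun C x => forall w, P w -> `|w x - w x0| <= C)) := M_compact.
case=> [x _|].
  have [C HC] : D x by rewrite DT.
  exists ([set y | forall w, P w -> `|w y - w x| <= 1], [set C' | C + 1 < C']).
    by split; [exact: near1|apply: nbhs_pinfty_gt; exact: num_real].
  move=> [y C'] /= [Hy CC'] w Pw.
  have -> : w y - w x0 = (w x - w x0) + (w y - w x) by ring.
  apply: le_trans (ler_normD _ _) _; apply: le_trans (ltW CC').
  by apply: lerD; [exact: HC|exact: Hy].
move=> B [_ /(_ (B + 1))]; rewrite ltrDl => /(_ ltr01) H.
exists ((B + 1) + (B + 1)) => w x y Pw.
have := H x I w Pw; have := H y I w Pw; rewrite !ler_norml => /andP[? ?] /andP[? ?].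
by lra.
Qed.

(** Ascoli's theorem in the form used below. Along an ultrafilter the values
    at each point converge; by equicontinuity and compactness the
    convergence is uniform. *)
Lemma equicont_cluster (P : set (M -> R)) (I : Type) (F : set_system I) (w : I -> M -> R) C :
  ProperFilter F -> equicont P -> F [set i | P (w i) /\ forall x, `|w i x| <= C] ->
  exists2 v : M -> R, continuous v &
    forall e Q, 0 < e -> F Q -> exists2 i, Q i & forall x, `|w i x - v x| <= e.
Proof.
move=> FF eqP FP; have [G [GU FG]] := ultraFilterLemma FF.
have GP : G [set i | P (w i) /\ forall x, `|w i x| <= C] by exact: FG.
have GF : ProperFilter G by exact: ultra_proper.
have EX x : exists p, forall e, 0 < e -> G [set i | `|w i x - p| <= e].
  have cC := @segment_compact R (- C) C.
  have [|p [_ cl]] := cC ((fun i => w i x) @ G) _.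
    rewrite /nbhs /=; apply: (filterS _ GP) => i [_ /(_ x)].
    by rewrite /= in_itv /= ler_norml.
  exists p => e e0; have [//|nG] := in_ultra_setVsetC [set i | `|w i x - p| <= e] GU.
  have N : \forall s \near p, `|s - p| <= e.
    have := @near_ball R R p e e0; apply: filterS => s /=.
    by rewrite -ball_normE /= distrC => /ltW.
  by have [i] := cluster_near _ cl N nG.
have [v vP] := choice EX.
have vdiff x y e : 0 < e -> (forall w, P w -> `|w y - w x| <= e) -> `|v y - v x| <= e.
  move=> e0 H; apply/ler_addgt0Pr => d d0.
  have d20 : 0 < d / 2 by rewrite divr_gt0.
  have [i [[/= h1 h2] [Pi _]]] := @filter_ex _ G _ _ (filterI (filterI (vP x _ d20) (vP y _ d20)) GP).
  have := H _ Pi; move: h1 h2; rewrite !ler_norml => /andP[? ?] /andP[? ?] /andP[? ?].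
  by apply/andP; split; lra.
exists v.
  move=> x; apply/cvgrPdist_le => e e0; have := eqP x e e0.
  by apply: filterS => y H; rewrite distrC; exact: vdiff.
move=> e Q e0 FQ.
have e30 : 0 < e / 3 by rewrite divr_gt0.
have : \forall i \near G, [set: M] `<=` (fun x => `|w i x - v x| <= e).
  have /compact_near_coveringP := M_compact; apply => x _.
  exists ([set y | forall w, P w -> `|w y - w x| <= e / 3],
     [set i | (P (w i) /\ forall x, `|w i x| <= C) /\ `|w i x - v x| <= e / 3]).
    by split; [exact: eqP|exact: (filterI GP (vP x _ e30))].
  move=> [y i] /= [Hy [[Pi _] Hi]].
  have := Hy _ Pi; have := vdiff _ _ _ e30 Hy; move: Hi.
  rewrite !ler_norml => /andP[? ?] /andP[? ?] /andP[? ?].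
  by apply/andP; split; lra.
move=> /(filterI (FG _ FQ)) /filter_ex[i [Qi Hi]].
by exists i => // x; exact: Hi.
Qed.

End Equicontinuity.

(** * Equicontinuity, convexity and comparison of subsolutions *)

Section SubsolTheory.
Context {R : realType} {n : nat} {M : topologicalType} (A : smooth_atlas R n M).
Local Notation V := 'rV[R]_n.
Implicit Types (i j : chart_index A) (x : M) (y : V) (u v f h w : M -> R).
Variable H : hamiltonian A.
Hypothesis M_compact : compact [set: M].
Hypothesis M_hausdorff : hausdorff_space M.
Variable rho : riemannian_metric A.
Hypothesis H_continuous : hamiltonian_continuous H.
Hypothesis H_coercive : hamiltonian_coercive rho H.

(** In a chart the test covectors are bounded by coercivity, so the
    Lipschitz estimate applies with a constant and on a ball that depend
    only on the bound [K] of the right-hand side. *)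
Lemma subsol_equicont K :
  equicont [set w | exists2 f, subsol H f w & forall x, f x <= K].
Proof.
move=> x0 e e0; have ix := @chart_atP _ _ _ A x0; set i := chart_at A x0 in ix.
pose y0 := chart i x0; have iy : chart_img i y0 by exact: chart_imgP.
have [C C0 HC] := coercive_local K H_coercive iy.
have Hi : \forall y \near y0, chart_img i y.
  by apply: open_nbhs_nbhs; split => //; exact: chart_img_open.
have [r r0 rP] := sq_near (filterI HC Hi).
(* passing from the sup norm to the Euclidean norm costs a factor [sqrt
   n], at most [n.+1] *)
pose L := n.+1%:R * C; have L0 : 0 < L by rewrite mulr_gt0.
have sqD (a b : V) : sq (a + b) <= 2 * sq a + 2 * sq b.
  rewrite /sq /dot !mulr_sumr -big_split /=; apply: ler_sum => k _.
  by rewrite !mxE; have := sqr_ge0 (a 0 k - b 0 k); rewrite expr2; lra.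
have Lip w f (y x : V) : subsol H f w -> (forall x, f x <= K) -> sq (y - y0) <= r / 4 ->
    sq (x - y) <= r / 4 / 2 ->
    w (chart_inv i x) <= w (chart_inv i y) + 2 * L * Num.sqrt (sq (x - y)).
  move=> wsub fK yr; have r40 : 0 < r / 4 by rewrite divr_gt0.
  have inr z : sq (z - y) <= r / 4 -> sq (z - y0) <= r.
    move=> zr; have -> : z - y0 = (z - y) + (y - y0) by rewrite addrA subrK.
    by apply: le_trans (sqD _ _) _; lra.
  apply: (lipschitz_of_supergradient (a := w \o chart_inv i) setT L0 r40) => [z /inr/rP[_ iz]|z phi G].
    by apply: continuous_comp; [exact: chart_inv_cont|case: wsub => + _; exact].
  move=> /ltW/inr/rP[Hz iz] phiG tch eqz.
  have : @H (chart_inv i z) (covec i (chart_inv i z) (1^-1 *: G z)) <= f (chart_inv i z).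
    apply: (touch_local M_compact M_hausdorff wsub iz ltr01 (C1_grad_subset _ phiG)) => //.
    by apply: filterS tch => t /=; move: eqz => /=; lra.
  move=> /le_trans/(_ (fK _))/Hz; rewrite invr1 scale1r => GC.
  apply: le_trans (sq_norm_le _) _; rewrite /L exprMn.
  apply: ler_pM => //.
    by rewrite -natrX ler_nat (leq_trans (leqnSn n)) // -{1}(expn1 n.+1) leq_pexp2l.
  by rewrite ler_pXn2r ?nnegrE // ltW.
pose d := Num.min (r / 4 / 2) ((e / (2 * L)) ^+ 2).
have d0 : 0 < d by rewrite lt_min !divr_gt0 //= exprn_gt0 // divr_gt0 // mulr_gt0.
have : \forall x \near x0, chart_dom i x /\ sq (chart i x - y0) < d.
  have N1 : \forall x \near x0, chart_dom i x.
    by apply: open_nbhs_nbhs; split => //; exact: chart_dom_open.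
  have N2 : \forall x \near x0, sq (chart i x - y0) < d.
    apply: (@near_lt _ _ (fun x => sq (chart i x - y0))); last by rewrite /= subrr sq0.
    apply: (@continuous_comp _ _ _ (chart i) (fun z => sq (z - y0))); last exact: continuous_sqB.
    exact: chart_cont.
  by apply: filterS2 N1 N2 => x.
apply: filterS => x [ix' /ltW xd] w [f wsub fK].
move: xd; rewrite le_min => /andP[xd1 xd2].
have eL : 0 < e / (2 * L) by rewrite divr_gt0 // mulr_gt0.
have xd3 : 2 * L * Num.sqrt (sq (chart i x - y0)) <= e.
  by rewrite mulrC -ler_pdivlMr ?mulr_gt0 // -[leRHS](gtr0_norm eL) -sqrtr_sqr ler_wsqrtr.
have y00 : sq (y0 - y0) <= r / 4 by rewrite subrr sq0 divr_ge0 // ltW.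
have L1 := Lip w f y0 (chart i x) wsub fK y00 xd1.
have xr4 : sq (chart i x - y0) <= r / 4 by lra.
have xd1' : sq (y0 - chart i x) <= r / 4 / 2 by rewrite sqBC.
have L2 := Lip w f (chart i x) y0 wsub fK xr4 xd1'.
move: L1 L2; rewrite [sq (y0 - _)]sqBC /y0 !chartE // -/y0 => L1 L2.
by rewrite ler_norml; apply/andP; split; lra.
Qed.

Lemma subsol_max (kappa : R -> R) u v :
  subsol H (kappa \o u) u -> subsol H (kappa \o v) v ->
  subsol H (kappa \o (fun x => Num.max (u x) (v x))) (fun x => Num.max (u x) (v x)).
Proof.
move=> [uc us] [vc vs]; split.
  by move=> x; apply: (@continuous_max R M u v x); [exact: uc|exact: vc].
move=> phi x0 Cphi uvphi eq0 /=.
have [uv|vu] := leP (u x0) (v x0).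
  apply: vs => // [x|]; first by apply: le_trans (uvphi x); rewrite le_max lexx orbT.
  by rewrite eq0 max_r.
apply: us => // [x|]; first by apply: le_trans (uvphi x); rewrite le_max lexx.
by rewrite eq0 max_l // ltW.
Qed.

(** By the sum rule the differential of a test function of the convex
    combination is the same combination of test covectors of [u] and [v]. *)
Lemma subsol_convex f h u v t : hamiltonian_convex H -> continuous f -> continuous h ->
  0 < t < 1 -> subsol H f u -> subsol H h v ->
  subsol H (fun x => (1 - t) * f x + t * h x) (fun x => (1 - t) * u x + t * v x).
Proof.
move=> Hconv fc hc /andP[t0 t1] us vs; have t10 : 0 < 1 - t by rewrite subr_gt0.
split.
  by apply: continuous_lincomb; [case: us|case: vs].
move=> phi x0 Cphi uvphi eq0.
have [p [q [<- Hp Hq]]] := sum_rule M_compact M_hausdorff H_continuous H_continuous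
  H_coercive fc hc us vs t10 t0 Cphi uvphi (esym eq0).
apply: le_trans (Hconv _ _ _ _ _) _; first by rewrite (ltW t0) (ltW t1).
by rewrite lerD // ler_pM2l.
Qed.

(** The sum rule for [u] and [- v] and a constant test function yields
    opposite covectors, that is, a common covector for [u] and [v]. *)
Lemma comparison_at_max f h u v x0 : continuous f -> continuous h ->
  subsol H f u -> subsol (Hopp H) (fun x => - h x) (fun x => - v x) ->
  (forall x, u x - v x <= u x0 - v x0) -> h x0 <= f x0.
Proof.
move=> fc hc us vs xm.
have hc' : continuous (fun x => - h x) by move=> x; apply: (@continuousN R R^o); exact: hc.
have [|||p [q [pq Hp Hq]]] := @sum_rule _ _ _ _ M_compact M_hausdorff rho H (Hopp H) f
  (fun x => - h x) u (fun x => - v x) 1 1 (fun=> u x0 - v x0) x0 H_continuous (Hopp_continuous H_continuous)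
  H_coercive fc hc' us vs ltr01 ltr01.
- exact: C1_cst.
- by move=> x; rewrite !mul1r.
- by rewrite !mul1r.
have E : \- q = p :> cotangent A x0.
  apply: cotangent_ext => w; move/(congr1 (fun c : cotangent A x0 => c w)) : pq.
  have E0 : covec (chart_at A x0) x0 0 w = 0 by exact: dot0l.
  rewrite dman_cst E0 /= !scale1r => /eqP.
  by rewrite addr_eq0 => /eqP ->.
by move: Hq; rewrite /Hopp E lerN2 => /le_trans; apply.
Qed.

End SubsolTheory.

(** * Perron's method *)

Section Perron.
Context {R : realType} {n : nat} {M : topologicalType} (A : smooth_atlas R n M).
Local Notation V := 'rV[R]_n.
Implicit Types (x : M) (u v f h w : M -> R).
Variable H : hamiltonian A.
Hypothesis M_compact : compact [set: M].
Hypothesis M_hausdorff : hausdorff_space M.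
Variable rho : riemannian_metric A.
Hypothesis H_continuous : hamiltonian_continuous H.
Hypothesis H_coercive : hamiltonian_coercive rho H.
Variable kappa : R -> R.
Hypothesis kappa_continuous : continuous kappa.
Hypothesis kappa_antitone : {homo kappa : s t / s <= t >-> t <= s}.

(** Subsolutions of [H(x, Dw) = kappa w]. *)
Definition implicit_subsol w := subsol H (kappa \o w) w.

(** If the supersolution inequality fails at a contact from below, the test
    function, made strict and raised slightly, is still a subsolution where
    it exceeds [u]; the maximum of both is then a larger subsolution. *)
Lemma maximal_subsol_super u : implicit_subsol u -> (forall w, implicit_subsol w -> forall x, w x <= u x) ->
  subsol (Hopp H) (fun x => - kappa (u x)) (fun x => - u x).
Proof.
move=> [uc us] umax; split; first by move=> x; apply: (@continuousN R R^o); exact: uc.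
move=> phi x0 Cphi uphi eq0; rewrite /Hopp lerN2 leNgt; apply/negP => lt0.
have [phi1 [C1phi le1 eq1 d1 st]] := strict_test M_compact M_hausdorff x0 Cphi.
have psi1C : C1 A (fun x => - phi1 x) by exact: C1N.
rewrite -d1 -(dmanN _ C1phi) in lt0.
have cpsi1 : continuous (fun x => - phi1 x) := C1_continuous psi1C.
set b := H _ in lt0; set a := kappa (u x0) in lt0.
pose c := (a + b) / 2.
have N1 : \forall x \near x0, @H x (dman A (fun x => - phi1 x) x) < c.
  by apply: near_lt; [exact: continuous_dman|rewrite -/b /c; lra].
have [r r0 N2] : exists2 r, 0 < r & forall s, `|u x0 - s| < r -> c < kappa s.
  have : \forall s \near u x0, c < kappa s.
    by apply: near_gt; [exact: kappa_continuous|rewrite -/a /c; lra].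
  by move=> /nbhs_ballP[r r0 N2]; exists r.
have N3 : \forall x \near x0, `|- phi1 x0 - - phi1 x| < r / 2.
  by have /cvgrPdist_lt := cpsi1 x0; apply; rewrite divr_gt0.
have [d d0 dN] := st _ (filterI N1 N3).
pose e := Num.min (r / 3) (d / 2).
have e0 : 0 < e by rewrite lt_min !divr_gt0.
have e1 : e <= r / 3 by rewrite ge_min lexx.
have e2 : e <= d / 2 by rewrite ge_min lexx orbT.
pose U x := Num.max (u x) (- phi1 x + e).
have Ce : C1 A (fun x => - phi1 x + e) by apply: C1D; [exact: psi1C|exact: C1_cst].
have US : implicit_subsol U.
  split.
    move=> x; apply: (@continuous_max R M u (fun x => - phi1 x + e) x); first exact: uc.
    exact: C1_continuous.
  move=> chi x Cchi Uchi chix; rewrite /= .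
  have [ux|xu] := leP (- phi1 x + e) (u x).
    have Ux : U x = u x by exact: max_l ux.
    rewrite Ux; apply: (us chi x Cchi) => [z|]; last by rewrite chix Ux.
    by apply: le_trans (Uchi z); rewrite le_max lexx.
  have Ux : U x = - phi1 x + e by exact: max_r (ltW xu).
  have px : phi1 x - phi x < d by have := uphi x; lra.
  have [/= X1 X3] := dN _ px.
  have <- : dman A (fun x => - phi1 x + e) x = dman A chi x.
    apply: (dman_touch Ce Cchi); last by rewrite chix Ux.
    by near=> z; apply: le_trans (Uchi z); rewrite le_max lexx orbT.
  rewrite (dman_addc _ _ psi1C) Ux; apply/ltW; apply: lt_trans X1 _; apply: N2.
  rewrite -[u x0]opprK -eq0 -eq1.
  by move: X3; rewrite !ltr_norml => /andP[? ?]; apply/andP; split; lra.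
have := umax _ US x0; rewrite /U ge_max => /andP[_].
by rewrite eq1 eq0; lra.
Unshelve. all: by end_near. Qed.

(** The largest subsolution is the supremum of all of them. It is continuous
    because those above [w0] have bounded right-hand sides, and are
    therefore equicontinuous. *)
Lemma perron w0 B : implicit_subsol w0 -> (forall w, implicit_subsol w -> forall x, w x <= B) ->
  exists u, [/\ implicit_subsol u, forall w, implicit_subsol w -> forall x, w x <= u x &
    subsol (Hopp H) (fun x => - kappa (u x)) (fun x => - u x)].
Proof.
move=> w0S wB.
pose E x : set R := [set w x | w in implicit_subsol].
have hsE x : has_sup (E x).
  by split; [exists (w0 x), w0|exists B => _ [w ws <-]; exact: wB].
pose u x := sup (E x).
have umax w x : implicit_subsol w -> w x <= u x.
  by move=> wS; apply: ub_le_sup; [case: (hsE x)|exists w].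
have uadh x e : 0 < e -> exists w, [/\ implicit_subsol w, forall y, w0 y <= w y & u x - e <= w x].
  move=> e0; have [_ [w wS <-] we] := sup_adherent e0 (hsE x).
  exists (fun y => Num.max (w y) (w0 y)); split.
  - exact: subsol_max.
  - by move=> y; rewrite le_max lexx orbT.
  - by rewrite le_max (ltW we).
have [K KP] : exists K, forall x, kappa (w0 x) <= K.
  have [[x _]|nM] := pselect ([set: M] !=set0); last first.
    by exists 0 => x; exfalso; apply: nM; exists x.
  have [m mP] := attains_min M_compact x w0S.1.
  by exists (kappa (w0 m)) => z; exact: kappa_antitone.
have eqc : equicont [set w | implicit_subsol w /\ forall y, w0 y <= w y].
  move=> x0 e e0; have := subsol_equicont M_compact M_hausdorff H_coercive K x0 e0.
  apply: filterS => x Hx w [wS w0w]; apply: Hx; exists (kappa \o w) => // y.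
  by apply: le_trans (KP y); exact: kappa_antitone.
have uc : continuous u.
  move=> x; apply/cvgrPdist_le => e e0; have e20 : 0 < e / 2 by rewrite divr_gt0.
  have := eqc x _ e20; apply: filterS => y Hy.
  have [w1 [w1S w1w H1]] := uadh x _ e20; have [w2 [w2S w2w H2]] := uadh y _ e20.
  have := Hy w1 (conj w1S w1w); have := Hy w2 (conj w2S w2w).
  have := umax _ y w1S; have := umax _ x w2S.
  rewrite !ler_norml => ? ? /andP[? ?] /andP[? ?]; apply/andP; split; lra.
have uS : implicit_subsol u.
  apply: subsol_stable => // x0 e e0.
  have [w [wS w0w we]] := uadh x0 e e0.
  exists w, (kappa \o w); split => // [x|x].
    by apply: le_trans (umax _ x wS) _; rewrite lerDl ltW.
  by rewrite lerDl ltW.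
exists u; split => //; first by move=> w wS x; exact: umax.
by apply: maximal_subsol_super => // w wS x; exact: umax.
Qed.

End Perron.

(** * Viscosity solutions in terms of subsolutions *)

Section Translation.
Context {R : realType} {n : nat} {M : topologicalType} (A : smooth_atlas R n M).
Implicit Types (x : M) (u v f h w : M -> R) (H : hamiltonian A).

Lemma subsol_le H f h u : subsol H f u -> (forall x, f x <= h x) -> subsol H h u.
Proof.
move=> [uc us] fh; split => // phi x0 Cphi uphi eq0.
exact: le_trans (us _ _ Cphi uphi eq0) (fh x0).
Qed.

Lemma subsol_subc H f u c : subsol H f u -> subsol H f (fun x => u x - c).
Proof.
move=> [uc us]; split.
  by move=> x; apply: (@continuousB R R^o M u (cst c) x); [exact: uc|exact: cst_continuous].
move=> phi x0 Cphi uphi eq0; rewrite -(dman_addc c x0 Cphi); apply: us.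
- by apply: C1D; [exact: Cphi|exact: C1_cst].
- by move=> x; have := uphi x; lra.
- by rewrite eq0 subrK.
Qed.

Lemma viscosity_subsolutionE H (k : R -> R) c u :
  viscosity_subsolution (fun x (p : cotangent A x) r => k r + H x p) c u <->
  subsol H (fun x => c - k (u x)) u.
Proof.
by split=> -[uc us]; split => // phi x0 Cphi uphi eq0;
  have := us phi x0 Cphi uphi eq0; rewrite eq0; lra.
Qed.

Lemma viscosity_supersolutionE H (k : R -> R) c u :
  viscosity_supersolution (fun x (p : cotangent A x) r => k r + H x p) c u <->
  subsol (Hopp H) (fun x => - (c - k (u x))) (fun x => - u x).
Proof.
split=> -[uc us]; split.
- by move=> x; apply: (@continuousN R R^o M u x); exact: uc.
- move=> phi x0 Cphi uphi eq0.
  have := us (fun x => - phi x) x0 (C1N Cphi); rewrite eq0 opprK (dmanN _ Cphi).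
  rewrite /Hopp => H1; suff : c <= k (u x0) + H x0 (\- dman A phi x0) by lra.
  by apply: H1 => // x; have := uphi x; lra.
- have -> : u = (fun x => - (- u x)) by apply/funext => x; rewrite opprK.
  by move=> x; apply: (@continuousN R R^o M (fun x => - u x) x); exact: uc.
- move=> psi x0 Cpsi upsi eq0.
  have := us (fun x => - psi x) x0 (C1N Cpsi); rewrite eq0 (dmanN _ Cpsi) /Hopp.
  have -> : \- (\- dman A psi x0 : cotangent A x0) = dman A psi x0 :> cotangent A x0.
    by apply: cotangent_ext => w; rewrite /= opprK.
  move=> H1; suff : - H x0 (dman A psi x0) <= - (c - k (u x0)) by lra.
  by apply: H1 => // x; rewrite lerN2.
Qed.

End Translation.

(** * The critical and the discounted equations *)

(** The arithmetic behind the comparison of three discount factors: [nu], [mu]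
    are the outer ones, [a], [b] the values of their solutions at a point, and
    [d] is the slope of the error made in replacing [g s - g 0] by [gam * s].
    The two first-order contributions add up to [lam] times the interpolated
    value, except for the term [S * (b - a)], which is small when [a] and [b]
    are close. *)
Lemma interpolation_estimate (R : realFieldType)
    (t S nu lam mu a b e d gam B : R) :
  0 <= gam -> 0 <= e -> 0 <= lam -> 0 <= S <= lam ->
  (1 - t) * nu = (1 - t) * lam - S -> t * mu = t * lam + S ->
  `|a - b| <= e -> d <= gam / 2 -> d * B <= gam * e / 4 ->
  gam * (lam * ((1 - t) * a + t * b - 3 * e)) + d * lam * (B + 3 * e) <=
  (1 - t) * (gam * (nu * a) - d * nu * B) + t * (gam * (mu * b) - d * mu * B).
Proof.
move=> gam0 e0 lam0 /andP[S0 Sl] tnu tmu; rewrite ler_norml => /andP[_ ab] d1 d2.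
rewrite -subr_ge0.
have -> : (1 - t) * (gam * (nu * a) - d * nu * B) +
    t * (gam * (mu * b) - d * mu * B) -
    (gam * (lam * ((1 - t) * a + t * b - 3 * e)) + d * lam * (B + 3 * e)) =
  (gam * a - d * B) * ((1 - t) * nu) + (gam * b - d * B) * (t * mu) -
    (gam * (lam * ((1 - t) * a + t * b - 3 * e)) + d * lam * (B + 3 * e)).
  by ring.
rewrite tnu tmu.
have -> : (gam * a - d * B) * ((1 - t) * lam - S) +
    (gam * b - d * B) * (t * lam + S) -
    (gam * (lam * ((1 - t) * a + t * b - 3 * e)) + d * lam * (B + 3 * e)) =
  gam * (S * (b - a) + lam * e) + 2 * (lam * (gam * e / 4 - d * B)) +
    3 * (lam * e * (gam / 2 - d)).
  by field.
have Sab : 0 <= S * (b - a) + lam * e.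
  have h1 : S * - e <= S * (b - a) by rewrite ler_wpM2l //; lra.
  have h2 : S * e <= lam * e by rewrite ler_wpM2r.
  by lra.
by rewrite !addr_ge0 // !mulr_ge0 // subr_ge0.
Qed.

Section Discount.
Context {R : realType} {n : nat} {M : topologicalType} (A : smooth_atlas R n M).
Implicit Types (x : M) (u v f h w : M -> R).
Hypothesis M_compact : compact [set: M].
Hypothesis M_hausdorff : hausdorff_space M.
Hypothesis M_connected : connected [set: M].
Variable m0 : M.
Variable rho : riemannian_metric A.
Variable H : hamiltonian A.
Hypothesis H_continuous : hamiltonian_continuous H.
Hypothesis H_coercive : hamiltonian_coercive rho H.

(** Normalize the subsolutions for [c + e] at [m0]; they are equicontinuous
    and bounded, so they have a uniform cluster point as [e] tends to 0. *)
Lemma critical_subsol (c : R) :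
  (forall e, 0 < e -> exists w, subsol H (fun=> c + e) w) ->
  exists2 w, subsol H (fun=> c) w & forall x, w x <= 0.
Proof.
move=> He.
have EX e : exists w, 0 < e -> subsol H (fun=> c + e) w /\ w m0 = 0.
  have [e0|e0] := ltP 0 e; last by exists (fun=> 0).
  have [w ws] := He e e0; exists (fun x => w x - w m0) => _.
  by split; [exact: subsol_subc|rewrite subrr].
have [w wP] := choice EX.
pose P := [set w : M -> R | exists2 f, subsol H f w & forall x, f x <= c + 1].
have eqP : equicont P by exact: (subsol_equicont M_compact M_hausdorff H_coercive).
have [C CP] := equicont_osc M_compact M_connected eqP.
pose F : set_system R := 0^'+.
have FF : ProperFilter F by exact: at_right_proper_filter.
have Fe b : 0 < b -> F [set e | 0 < e < b] by exact: at_right0_itv.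
have [|v vc vP] := @equicont_cluster R M M_compact P R F w C FF eqP.
  apply: (filterS _ (Fe 1 ltr01)) => e /andP[e0 e1].
  have [ws w0] := wP e e0.
  have Pw : P (w e) by exists (fun=> c + e) => // x; rewrite lerD2l ltW.
  split => // x; have := CP _ x m0 Pw; have := CP _ m0 x Pw; rewrite w0 => ? ?.
  by rewrite ler_norml; apply/andP; split; lra.
have vs : subsol H (fun=> c) v.
  apply: (@subsol_stable _ _ _ A M_compact M_hausdorff H (fun=> c) v H_continuous) => //.
    exact: cst_continuous.
  move=> x0 e e0; have [e' /andP[e'0 e'e] Hw] := vP e _ e0 (Fe e e0).
  have [ws _] := wP e' e'0; exists (w e'), (fun=> c + e'); split => //.
  - by move=> x; have := Hw x; rewrite ler_norml => /andP[? ?]; lra.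
  - by have := Hw x0; rewrite ler_norml => /andP[? ?]; lra.
  - by move=> _; rewrite lerD2l ltW.
have [xm xmP] := attains_max M_compact m0 vc.
by exists (fun x => v x - v xm); [exact: subsol_subc|move=> x; rewrite subr_le0].
Qed.

Variables (g : R -> R) (c0 : R).
Hypothesis g_continuous : continuous g.
Hypothesis g_increasing : {homo g : s t / s < t}.
Variable w0 : M -> R.
Hypothesis w0_sub : subsol H (fun=> c0 - g 0) w0.
Hypothesis w0_le0 : forall x, w0 x <= 0.
Hypothesis no_strict : forall d w, 0 < d -> ~ subsol H (fun=> c0 - g 0 - d) w.

(** The right-hand side of the discounted equation: [g (lam u) + H(x, Du) = c0]
    reads [H(x, Du) = discount_rhs lam u]. *)
Definition discount_rhs (lam r : R) : R := c0 - g (lam * r).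

Let g_nd s t : s <= t -> g s <= g t.
Proof. by rewrite le_eqVlt => /predU1P[->|/g_increasing/ltW]. Qed.

Lemma discount_rhs_continuous lam : continuous (discount_rhs lam).
Proof.
move=> r; apply: (@continuousB R R^o R (cst c0) (fun r => g (lam * r))); first exact: cst_continuous.
apply: (@continuous_comp _ _ _ (fun r => lam * r) g); last exact: g_continuous.
by apply: (@continuousM R R (cst lam) id r); [exact: cst_continuous|exact: cvg_id].
Qed.

Lemma discount_rhs_antitone lam : 0 < lam ->
  {homo discount_rhs lam : s t / s <= t >-> t <= s}.
Proof.
by move=> l0 s t st; rewrite /discount_rhs lerD2l lerN2; apply: g_nd; rewrite ler_pM2l.
Qed.

(** The normalization [w0 <= 0] makes the critical subsolution a subsolution of
    every discounted equation, so that it bounds all maximal ones from below. *)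
Lemma discount_rhs_w0 lam : 0 < lam -> implicit_subsol H (discount_rhs lam) w0.
Proof.
move=> l0; apply: subsol_le w0_sub _ => x; rewrite lerD2l lerN2; apply: g_nd.
by rewrite mulr_ge0_le0 // ltW.
Qed.

(** Bounds uniform in [lam].  A subsolution that is positive everywhere would
    be a strict critical subsolution, against the definition of the critical
    value; so its minimum is at most 0, and the uniform bound on oscillations
    turns this into an upper bound.  Taking the maximum with [w0] first makes
    that oscillation bound available. *)
Lemma discount_bounds : exists m B K, [/\ forall x, m <= w0 x,
  (forall lam w x, 0 < lam < 1 -> m <= w x -> discount_rhs lam (w x) <= K) &
  forall lam w, 0 < lam < 1 -> implicit_subsol H (discount_rhs lam) w ->
    forall x, w x <= B].
Proof.
have w0c : continuous w0 by case: w0_sub.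
have [xm xmP] := attains_min M_compact m0 w0c.
set m := w0 xm.
have m_le0 : m <= 0 by exact: w0_le0.
pose K := c0 - g m.
have KP lam (w : M -> R) x : 0 < lam < 1 -> m <= w x -> discount_rhs lam (w x) <= K.
  move=> /andP[l0 l1] mw; rewrite /discount_rhs lerD2l lerN2; apply: g_nd.
  have : lam * m <= lam * w x by rewrite ler_pM2l.
  by apply: le_trans; nra.
pose P := [set w : M -> R | exists2 f, subsol H f w & forall x, f x <= K].
have eqP : equicont P by exact: (subsol_equicont M_compact M_hausdorff H_coercive).
have [C CP] := equicont_osc M_compact M_connected eqP.
exists m, C, K; split => // lam w l01 ws x.
have /andP[l0 l1] := l01.
pose W x := Num.max (w x) (w0 x).
have Ws : implicit_subsol H (discount_rhs lam) W.
  by apply: subsol_max => //; exact: discount_rhs_w0.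
have WP : P W.
  exists (discount_rhs lam \o W) => // z; apply: KP => //.
  by apply: le_trans (xmP z) _; rewrite le_max lexx orbT.
have [z zP] := attains_min M_compact m0 Ws.1.
have Wz : W z <= 0.
  rewrite leNgt; apply/negP => Wz.
  apply: (@no_strict (g (lam * W z) - g 0) W).
    by rewrite subr_gt0; apply: g_increasing; rewrite mulr_gt0.
  apply: subsol_le Ws _ => y /=; rewrite /discount_rhs.
  have : g (lam * W z) <= g (lam * W y) by apply: g_nd; rewrite ler_pM2l.
  by lra.
have := CP W x z WP; have : w x <= W x by rewrite le_max lexx.
by lra.
Qed.

(** A solution is recorded together with its maximality among subsolutions,
    which is what comparisons from below use. *)
Definition discounted lam u := [/\ implicit_subsol H (discount_rhs lam) u,
  forall w, implicit_subsol H (discount_rhs lam) w -> forall x, w x <= u x &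
  subsol (Hopp H) (fun x => - discount_rhs lam (u x)) (fun x => - u x)].

Lemma discounted_solutions : exists B K, exists2 u : R -> M -> R, 0 < B &
  forall lam, 0 < lam < 1 -> [/\ discounted lam (u lam),
    forall x, `|u lam x| <= B & forall x, discount_rhs lam (u lam x) <= K].
Proof.
have [m [B [K [mw KP wB]]]] := discount_bounds.
have EX lam : exists u, 0 < lam < 1 -> discounted lam u.
  have [l01|] := boolP (0 < lam < 1); last by exists (fun=> 0).
  have /andP[l0 l1] := l01.
  have [u uP] := perron M_compact M_hausdorff H_continuous H_coercive
    (@discount_rhs_continuous lam) (discount_rhs_antitone l0) (discount_rhs_w0 l0)
    (fun w => @wB lam w l01).
  by exists u.
have [u uP] := choice EX.
exists (`|m| + `|B| + 1), K, u; first by rewrite ltr_wpDl ?addr_ge0.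
move=> lam l01; have /andP[l0 _] := l01.
have um x : m <= u lam x.
  apply: le_trans (mw x) _; have [_ umax _] := uP lam l01.
  by apply: umax; exact: discount_rhs_w0.
split => [|x|x]; [exact: uP| |exact: KP].
have [us _ _] := uP lam l01; have := wB lam _ l01 us x; have := um x.
have := ler_norm B; have := ler_norm (- m); rewrite normrN.
have := normr_ge0 B; have := normr_ge0 m => *.
by rewrite ler_norml; apply/andP; split; lra.
Qed.

(** Uniqueness: a solution lies below the maximal subsolution; conversely the
    right-hand sides compare at a maximum point of the difference, and [g] is
    strictly increasing. *)
Lemma discounted_unique lam u v : 0 < lam -> discounted lam u ->
  implicit_subsol H (discount_rhs lam) v ->
  subsol (Hopp H) (fun x => - discount_rhs lam (v x)) (fun x => - v x) -> u = v.
Proof.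
move=> l0 [us umax _] vs vsup.
apply/funext => x; apply/eqP; rewrite eq_le umax // andbT.
have [xm xmP] : exists xm, forall z, u z - v z <= u xm - v xm.
  apply: (attains_max M_compact m0) => z.
  by apply: (@continuousB R R^o M u v z); [exact: us.1|exact: vs.1].
have rhsc w : continuous w -> continuous (discount_rhs lam \o w).
  by move=> wc z; apply: continuous_comp; [exact: wc|exact: discount_rhs_continuous].
have := comparison_at_max M_compact M_hausdorff H_continuous H_coercive
  (rhsc _ us.1) (rhsc _ vs.1) us vsup xmP.
rewrite /= /discount_rhs lerD2l lerN2 => guv.
have uv : u xm <= v xm.
  rewrite leNgt; apply/negP => vu; move: guv; rewrite leNgt => /negP; apply.
  by apply: g_increasing; rewrite ltr_pM2l.
by have := xmP x; lra.
Qed.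

Hypothesis H_convex : hamiltonian_convex H.
Variable gam : R.
Hypothesis gam0 : 0 < gam.
Hypothesis g_diff : forall d, 0 < d -> exists2 r, 0 < r &
  forall s, `|s| < r -> `|g s - g 0 - gam * s| <= d * `|s|.
Variables (B K : R) (u : R -> M -> R).
Hypothesis B0 : 0 < B.
Hypothesis uP : forall lam, 0 < lam < 1 -> [/\ discounted lam (u lam),
  forall x, `|u lam x| <= B & forall x, discount_rhs lam (u lam x) <= K].

(** Where the selection of the limit comes from.  The interpolation
    [(1 - t) u_nu + t u_mu], with [t] such that [(1 - t) nu + t mu = lam], is
    by convexity a subsolution for a right-hand side that agrees with that of
    the equation with discount [lam] up to [lam] times a small constant; after
    subtracting [3 e] it is a genuine subsolution, hence lies below the maximal
    one, [u lam]. *)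
Lemma discount_sandwich e : 0 < e -> exists2 r, 0 < r & forall nu lam mu,
  0 < nu -> nu < lam -> lam < mu -> mu < r ->
  (forall x, `|u nu x - u mu x| <= e) ->
  forall x, u nu x <= u lam x + 4 * e.
Proof.
move=> e0.
(* the slope error makes up at most the half of [gam] in the strict gain [3 e] *)
pose d := Num.min (gam / 2) (gam * e / (4 * B)).
have d0 : 0 < d by rewrite lt_min !divr_gt0 // mulr_gt0.
have d1 : d <= gam / 2 by rewrite ge_min lexx.
have d2 : d * B <= gam * e / 4.
  have : d <= gam * e / (4 * B) by rewrite ge_min lexx orbT.
  by rewrite ler_pdivlMr ?mulr_gt0 //; lra.
have [r r0 gr] := g_diff d0.
have Be : 0 < B + 3 * e by rewrite addr_gt0 // mulr_gt0.
exists (Num.min 1 (r / (B + 3 * e))); first by rewrite lt_min ltr01 divr_gt0.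
move=> nu lam mu nu0 nl lm; rewrite lt_min ltr_pdivlMr // => /andP[mu1 mur] close.
have lam0 : 0 < lam by apply: lt_trans nl.
have mu0 : 0 < mu by apply: lt_trans lm.
have lam1 : lam < 1 by apply: lt_trans mu1.
have nu1 : nu < 1 by apply: lt_trans lam1.
have nu01 : 0 < nu < 1 by rewrite nu0.
have lam01 : 0 < lam < 1 by rewrite lam0.
have mu01 : 0 < mu < 1 by rewrite mu0.
have [[us1 _ _] b1 _] := uP nu01.
have [[us2 _ _] b2 _] := uP mu01.
have [[_ umax _] _ _] := uP lam01.
pose t := (lam - nu) / (mu - nu).
have nm : nu < mu by apply: lt_trans lm.
have mn0 : 0 < mu - nu by rewrite subr_gt0.
have t0 : 0 < t by rewrite divr_gt0 // subr_gt0.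
have t1 : t < 1 by rewrite ltr_pdivrMr // mul1r ltrD2r.
have t01 : 0 < t < 1 by rewrite t0.
have rhsc k w : continuous w -> continuous (discount_rhs k \o w).
  by move=> wc z; apply: continuous_comp; [exact: wc|exact: discount_rhs_continuous].
have := subsol_convex M_compact M_hausdorff H_continuous H_coercive H_convex
  (rhsc _ _ us1.1) (rhsc _ _ us2.1) t01 us1 us2.
move=> /(subsol_subc (3 * e)) ws.
have g_lin s c C : 0 <= c -> c <= mu -> C <= B + 3 * e -> `|s| <= C ->
    `|g (c * s) - g 0 - gam * (c * s)| <= d * c * C.
  move=> c_ge0 cmu CB sC; have : `|c * s| < r.
    rewrite normrM ger0_norm //; apply: le_lt_trans mur.
    by apply: ler_pM => //; exact: le_trans CB.
  move=> /gr /le_trans; apply.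
  by rewrite normrM ger0_norm // -mulrA ler_pM2l // ler_wpM2l.
pose S := t * (mu - lam).
have tnu : (1 - t) * nu = (1 - t) * lam - S by rewrite /S /t; field; rewrite gt_eqF.
have tmu : t * mu = t * lam + S by rewrite /S; ring.
have S0 : 0 <= S by rewrite mulr_ge0 ?subr_ge0 // ltW.
have Sl : S <= lam.
  have h1 : 0 <= (1 - t) * nu by rewrite mulr_ge0 ?subr_ge0 // ltW.
  have h2 : 0 <= t * lam by rewrite mulr_ge0 // ltW.
  by rewrite tnu in h1; lra.
have KS : implicit_subsol H (discount_rhs lam)
    (fun x => ((1 - t) * u nu x + t * u mu x) - 3 * e).
  apply: subsol_le ws _ => x /=; rewrite /discount_rhs.
  have aB := b1 x; have bB := b2 x; have ab := close x.
  move: (u nu x) (u mu x) aB bB ab => a b aB bB ab.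
  have pB : `|(1 - t) * a + t * b - 3 * e| <= B + 3 * e.
    apply: le_trans (ler_normB _ _) _; rewrite (gtr0_norm (_ : 0 < 3 * e)) ?mulr_gt0 //.
    rewrite lerD2r; apply: le_trans (ler_normD _ _) _.
    rewrite normrM [X in _ + X]normrM (gtr0_norm t0) (gtr0_norm (_ : 0 < 1 - t)) ?subr_gt0 //.
    have h1 : (1 - t) * `|a| <= (1 - t) * B by rewrite ler_pM2l // subr_gt0.
    have h2 : t * `|b| <= t * B by rewrite ler_pM2l.
    by apply: le_trans (lerD h1 h2) _; rewrite -mulrDl subrK mul1r.
  have B_le : B <= B + 3 * e by rewrite lerDl mulr_ge0 // ltW.
  have := g_lin _ _ _ (ltW nu0) (ltW nm) B_le aB; rewrite ler_norml => /andP[Ga _].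
  have := g_lin _ _ _ (ltW mu0) (lexx _) B_le bB; rewrite ler_norml => /andP[Gb _].
  have := g_lin _ _ _ (ltW lam0) (ltW lm) (lexx _) pB; rewrite ler_norml => /andP[_ Gp].
  have I := interpolation_estimate (ltW gam0) (ltW e0) (ltW lam0) (introT andP (conj S0 Sl)) tnu tmu ab d1 d2.
  have X1 : (1 - t) * (g 0 + (gam * (nu * a) - d * nu * B)) <= (1 - t) * g (nu * a).
    by rewrite ler_pM2l ?subr_gt0 //; lra.
  have X2 : t * (g 0 + (gam * (mu * b) - d * mu * B)) <= t * g (mu * b).
    by rewrite ler_pM2l //; lra.
  by lra.
move=> x; have := umax _ KS x; have := close x.
rewrite ler_norml => /andP[_ h2] h3.
have h4 : t * (u nu x - u mu x) <= t * e by rewrite ler_pM2l.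
have h5 : t * e <= 1 * e by rewrite ler_pM2r // ltW.
by lra.
Qed.

(** A cluster point, in the sup norm, of the family [u lam] as [lam] tends
    to 0 from the right. *)
Definition discount_cluster (v : M -> R) := forall e (Q : set R), 0 < e ->
  (0^'+ : set_system R) Q -> exists2 lam, Q lam & forall x, `|u lam x - v x| <= e.

(** Choose [mu] and then [nu] along the family that clusters at [v], and [lam]
    between them along the one that clusters at [v']. *)
Lemma discount_cluster_le v v' : discount_cluster v -> discount_cluster v' ->
  forall x, v x <= v' x.
Proof.
move=> vP v'P x; apply/ler_addgt0Pr => e1 e10.
pose e := e1 / 8; have e0 : 0 < e by rewrite divr_gt0.
have e20 : 0 < e / 2 by rewrite divr_gt0.
have [r r0 rP] := discount_sandwich e0.
have [mu /andP[mu0 mur] muP] := vP _ _ e20 (at_right0_itv r0).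
have [lam /andP[l0 lmu] lP] := v'P _ _ e0 (at_right0_itv mu0).
have [nu /andP[nu0 nl] nP] := vP _ _ e20 (at_right0_itv l0).
have close y : `|u nu y - u mu y| <= e.
  have -> : u nu y - u mu y = (u nu y - v y) - (u mu y - v y) by ring.
  by apply: le_trans (ler_normB _ _) _; rewrite (splitr e) lerD.
have := rP nu lam mu nu0 nl lmu mur close x; have := lP x; have := nP x.
rewrite !ler_norml => /andP[? ?] /andP[? ?] ?.
have -> : e1 = 8 * e by rewrite /e; field.
by lra.
Qed.

(** Compactness gives a cluster point along every filter finer than that of
    right neighborhoods of 0, and all of them coincide. *)
Lemma discount_limit : exists2 v, continuous v &
  forall e, 0 < e -> \forall lam \near 0^'+, forall x, `|u lam x - v x| <= e.
Proof.
pose F : set_system R := 0^'+.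
have FF : ProperFilter F by exact: at_right_proper_filter.
pose P := [set w : M -> R | exists2 f, subsol H f w & forall x, f x <= K].
have eqP : equicont P by exact: (subsol_equicont M_compact M_hausdorff H_coercive).
have PP lam : 0 < lam < 1 -> P (u lam) /\ forall x, `|u lam x| <= B.
  by move=> /uP[[us _ _] uB uK]; split => //; exists (discount_rhs lam \o u lam).
have F1 : F [set lam | P (u lam) /\ forall x, `|u lam x| <= B].
  by apply: (filterS _ (at_right0_itv ltr01)) => lam; exact: PP.
have [v vc vP] := equicont_cluster M_compact FF eqP F1.
exists v => // e e0; apply: contrapT => nF.
pose bad := ~` [set lam | forall x, `|u lam x - v x| <= e].
have Fw Q : F Q -> within bad F Q by move=> FQ; apply: filterS FQ => lam.
have FF' : ProperFilter (within bad F).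
  apply: Build_ProperFilter => H0; apply: nF.
  move: H0; rewrite /within /=; apply: (@filterS _ F) => lam; rewrite /bad /= => H1.
  by apply: contrapT => /H1.
have [v' v'c v'P] := equicont_cluster M_compact FF' eqP (Fw _ F1).
have v'n : discount_cluster v' by move=> e' Q e'0 /Fw; exact: v'P.
have Fbad : within bad F bad by rewrite /within /=; near=> lam.
have [lam lbad lP] := v'P _ _ e0 Fbad.
apply: lbad => x /=.
have -> : v x = v' x by apply: le_anti; rewrite !discount_cluster_le.
exact: lP.
Unshelve. all: by end_near. Qed.

(** The discounted right-hand sides tend to the constant [c0 - g 0] uniformly,
    the solutions being bounded. *)
Lemma discount_rhs_cvg e : 0 < e -> exists2 r, 0 < r & forall lam (s : R),
  0 < lam < r -> `|s| <= B -> `|discount_rhs lam s - (c0 - g 0)| <= e.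
Proof.
move=> e0; have /cvgrPdist_le/(_ e e0)/nbhs_ballP[r r0 gr] := @g_continuous 0.
exists (r / (B + 1)); first by rewrite divr_gt0 // addr_gt0.
move=> lam s /andP[l0]; rewrite ltr_pdivlMr ?addr_gt0 // => lr sB.
have -> : discount_rhs lam s - (c0 - g 0) = g 0 - g (lam * s) by rewrite /discount_rhs; ring.
apply: gr; rewrite /ball /= sub0r normrN normrM gtr0_norm //.
by apply: le_lt_trans lr; rewrite ler_pM2l // (le_trans sB) // lerDl.
Qed.

Lemma discount_limit_solution v : continuous v ->
  (forall e, 0 < e -> \forall lam \near 0^'+, forall x, `|u lam x - v x| <= e) ->
  subsol H (fun=> c0 - g 0) v /\
  subsol (Hopp H) (fun=> - (c0 - g 0)) (fun x => - v x).
Proof.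
move=> vc uv.
have pick e : 0 < e -> exists lam, [/\ 0 < lam < 1, forall x, `|u lam x - v x| <= e &
    forall x, `|discount_rhs lam (u lam x) - (c0 - g 0)| <= e].
  move=> e0; have [r r0 rP] := discount_rhs_cvg e0.
  have FF : ProperFilter (0^'+ : set_system R) by exact: at_right_proper_filter.
  have [lam [[lr l01] ul]] :=
    filter_ex (filterI (filterI (at_right0_itv r0) (at_right0_itv ltr01)) (uv e e0)).
  exists lam; split => // x.
  by apply: rP => //; case: (uP l01).
split.
  apply: (@subsol_stable _ _ _ A M_compact M_hausdorff H (fun=> c0 - g 0) v H_continuous) => //.
    exact: cst_continuous.
  move=> x0 e /pick[lam [l01 ul rl]]; have [[us _ _] _ _] := uP l01.
  exists (u lam), (discount_rhs lam \o u lam); split => [//|x||x].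
  - by have := ul x; rewrite ler_norml => /andP[? ?]; lra.
  - by have := ul x0; rewrite ler_norml => /andP[? ?]; lra.
  - by have := rl x; rewrite ler_norml /= => /andP[? ?]; lra.
apply: (@subsol_stable _ _ _ A M_compact M_hausdorff (Hopp H) (fun=> - (c0 - g 0))
  (fun x => - v x) (Hopp_continuous H_continuous)) => //.
- exact: cst_continuous.
- by move=> x; apply: (@continuousN R R^o M v x); exact: vc.
move=> x0 e /pick[lam [l01 ul rl]]; have [[_ _ us] _ _] := uP l01.
exists (fun x => - u lam x), (fun x => - discount_rhs lam (u lam x)); split => [//|x||x].
- by have := ul x; rewrite ler_norml => /andP[? ?]; lra.
- by have := ul x0; rewrite ler_norml => /andP[? ?]; lra.
- by have := rl x; rewrite ler_norml /= => /andP[? ?]; lra.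
Qed.

End Discount.

Theorem corollary1p7 (R : realType) (n : nat) (M : topologicalType)
    (A : smooth_atlas R n M) (rho : riemannian_metric A)
    (M_nonempty : [set: M] !=set0)
    (M_hausdorff : hausdorff_space M)
    (M_compact : compact [set: M])
    (M_connected : connected [set: M])
    (H : hamiltonian A)
    (H_continuous : hamiltonian_continuous H)
    (H_convex : hamiltonian_convex H)
    (H_coercive : hamiltonian_coercive rho H)
    (g : R -> R)
    (g_continuous : continuous g)
    (g_increasing : {homo g : s t / s < t})
    (g_derivable : derivable g 0 1)
    (g_derive_gt0 : 0 < 'D_1 g 0)
    (c0 : R)
    (c0E : c0 = critical_value (fun x (p : cotangent A x) => g 0 + H x p)) :
  exists u : R -> M -> R,
    (exists2 lam0 : R, 0 < lam0 & forall lam, 0 < lam < lam0 ->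
       unique (viscosity_solution
         (fun x (p : cotangent A x) r => g (lam * r) + H x p) c0) (u lam)) /\
    exists2 u0 : M -> R,
      viscosity_solution (fun x (p : cotangent A x) _ => g 0 + H x p) c0 u0 &
      {uniform, u lam @[lam --> 0^'+] --> u0}.
Proof.
have [m0 _] := M_nonempty.
pose S := [set c | exists v,
  viscosity_subsolution (fun x (p : cotangent A x) (_ : R) => g 0 + H x p) c v].
have c0S : c0 = inf S by [].
have SP c v : viscosity_subsolution
    (fun x (p : cotangent A x) (_ : R) => g 0 + H x p) c v <->
  subsol H (fun=> c - g 0) v by exact: (viscosity_subsolutionE H (fun=> g 0) c v).
have cdc : continuous (fun x => H x (dman A (fun=> 0) x)).
  by apply: (continuous_dman H_continuous); exact: C1_cst.
(* constants are subsolutions for a large [c]; at a maximum point a constant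
   test function bounds every admissible [c] from below *)
have S_inf : has_inf S.
  split.
    have [xm xmP] := attains_max M_compact m0 cdc.
    exists (g 0 + H xm (dman A (fun=> 0) xm)), (fun=> 0); apply/SP.
    split; first exact: cst_continuous.
    move=> phi x0 Cphi phi0 eq0; rewrite addrC addKr.
    rewrite -(dman_touch (@C1_cst _ _ _ A 0) Cphi) //; by near=> z.
  have [xm xmP] := attains_min M_compact m0 cdc.
  exists (g 0 + H xm (dman A (fun=> 0) xm)) => c [v /SP[vc vs]].
  have [y ym] := attains_max M_compact m0 vc.
  have := vs (fun=> v y) y (@C1_cst _ _ _ A (v y)) ym erefl.
  by have := xmP y; rewrite !dman_cst; lra.
have [w0 w0s w0le] : exists2 w, subsol H (fun=> c0 - g 0) w & forall x, w x <= 0.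
  apply: (critical_subsol M_compact M_hausdorff M_connected m0 H_continuous H_coercive).
  move=> e e0; have [c [v /SP vs] cc0] := inf_adherent e0 S_inf.
  by exists v; apply: subsol_le vs _ => _; rewrite -c0S in cc0; lra.
have no_strict d w : 0 < d -> ~ subsol H (fun=> c0 - g 0 - d) w.
  move=> d0 ws; have : S (c0 - d).
    by exists w; apply/SP; apply: subsol_le ws _ => _; lra.
  by move=> /(ge_inf S_inf.2); rewrite -c0S; lra.
have [B [K [u B0 uP]]] := discounted_solutions M_compact M_hausdorff M_connected m0
  H_continuous H_coercive g_continuous g_increasing w0s w0le no_strict.
have g_diff d : 0 < d -> exists2 r, 0 < r &
    forall s, `|s| < r -> `|g s - g 0 - 'D_1 g 0 * s| <= d * `|s|.
  move=> d0; have /eqaddoP/(_ d d0)/nbhs_ballP[r r0 H1] := derivable_nbhs g_derivable.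
  exists r => // s sr; have := H1 s; rewrite /ball /= sub0r normrN => /(_ sr).
  by rewrite !fctE /= addr0 [s *: 1]mulr1 opprD addrA [s *: _]mulrC.
have [v vc uv] := discount_limit M_compact M_hausdorff H_continuous H_coercive
  g_continuous H_convex g_derive_gt0 g_diff B0 uP.
have [v_sub v_sup] := discount_limit_solution M_compact M_hausdorff H_continuous
  g_continuous B0 uP vc uv.
exists u; split.
  exists 1 => // lam l01; have [udisc _ _] := uP lam l01; have [us umax usup] := udisc.
  split.
    split; first exact/(viscosity_subsolutionE H (fun r => g (lam * r)) c0).
    exact/(viscosity_supersolutionE H (fun r => g (lam * r)) c0).
  move=> w [/(viscosity_subsolutionE H (fun r => g (lam * r)) c0) ws
           /(viscosity_supersolutionE H (fun r => g (lam * r)) c0) wsup].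
  have /andP[l0 _] := l01.
  exact: (discounted_unique M_compact M_hausdorff m0 H_continuous H_coercive
    g_continuous g_increasing l0 udisc ws wsup).
exists v.
  split; first exact/(viscosity_subsolutionE H (fun=> g 0) c0).
  exact/(viscosity_supersolutionE H (fun=> g 0) c0).
move=> Q /uniform_nbhs[E []]; rewrite -entourage_from_ballE => -[e e0 eE] EQ.
have e20 : 0 < e / 2 by rewrite divr_gt0.
apply: filterS (uv _ e20) => lam Hl; apply: EQ => y _; apply: eE => /=.
rewrite -ball_normE /= distrC; apply: le_lt_trans (Hl y) _.
by rewrite gtr_pMr // invf_lt1 // ltr1n.
Unshelve. all: by end_near. Qed.
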